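(* Let $\Pi \subseteq \Psi$ be classes of graphs. Let $\textsc{Del}\Pi$ be the parameterized problem: given a graph $G$ and $k \in \mathbb{N}$ (the parameter), decide whether there is a set $S \subseteq V(G)$ with $|S| \le k$ such that $G - S \in \Pi$. Let $\textsc{ResDel}\Pi$ be the restriction of $\textsc{Del}\Pi$ to input graphs $G \in \Psi$. If $\Psi$ is characterized by a finite set $\Phi$ of forbidden induced subgraphs and $\textsc{ResDel}\Pi \in \textsc{para-L}$, then $\textsc{Del}\Pi \in \textsc{para-L}$.
   Context: A parameterized problem is a pair $(A,t)$ of a decision problem $A$ and a computable parameterization $t$; an instance is $(I,t(I))$, with $n=|I|$ and $k=t(I)$. The class $\textsc{para-L}$ consists of all parameterized problems solvable by a deterministic algorithm using $f(k) + O(\log n)$ bits of space, for some computable $f:\mathbb{N}\to\mathbb{N}$. The machine model: the input is in read-only random-access memory, output is written to a write-only stream, and only the auxiliary read-write memory counts towards space. A class $\Psi$ of graphs is characterized by a set $\Phi$ of forbidden induced subgraphs if $\Psi$ consists of exactly the graphs having no induced subgraph isomorphic to a graph in $\Phi$. *)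

(* Defs.v *)
From mathcomp Require Import all_boot.
From Stdlib Require List.

Set Implicit Arguments.
Unset Strict Implicit.
Unset Printing Implicit Defensive.

(** * Machine model

  Deterministic programs over finitely many registers holding natural numbers.
  The input is a read-only bit string with random access; it is not charged.
  The space of a store is the total binary length of the registers of the
  program.  A register is unbounded and the arithmetic operations give access
  to any block of its bits, so a single register can serve as an arbitrarily
  long work tape, and s bits of space here are s bits of auxiliary read-write
  memory up to a constant factor (hence indirect addressing is not needed).
  The answer is the final value of register 0; for a decision problem this
  replaces the one-bit output stream. *)

Definition store := nat -> nat.

Definition upd (s : store) (x v : nat) : store :=
  fun y => if y == x then v else s y.

Inductive binop := Add | Sub | Mul | Div | Mod.

Definition eval_binop (o : binop) : nat -> nat -> nat :=
  match o with
  | Add => addn | Sub => subn | Mul => muln | Div => divn | Mod => modn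
  end.

Inductive cmd :=
| Skip
| Const (x m : nat)
| Op (o : binop) (x y z : nat)
| Read (x y : nat)
| Seq (c1 c2 : cmd)
| If (x : nat) (c1 c2 : cmd)
| While (x : nat) (c : cmd).

Fixpoint width (c : cmd) : nat :=
  match c with
  | Skip => 1
  | Const x _ => x.+1
  | Op _ x y z => maxn x.+1 (maxn y.+1 z.+1)
  | Read x y => maxn x.+1 y.+1
  | Seq c1 c2 => maxn (width c1) (width c2)
  | If x c1 c2 => maxn x.+1 (maxn (width c1) (width c2))
  | While x c1 => maxn x.+1 (width c1)
  end.

(* The value 2 signals an address past the end of the input. *)
Definition read_input (w : seq bool) (a : nat) : nat :=
  nth 2 [seq nat_of_bool b | b <- w] a.

(* [exec w ok c s s']: on input w, c started in s halts in s', and every store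
   reached after s satisfies ok.  A test succeeds when the register is
   nonzero. *)
Inductive exec (w : seq bool) (ok : pred store) :
    cmd -> store -> store -> Prop :=
| exec_skip s : exec w ok Skip s s
| exec_const x m s :
    ok (upd s x m) -> exec w ok (Const x m) s (upd s x m)
| exec_op o x y z s :
    ok (upd s x (eval_binop o (s y) (s z))) ->
    exec w ok (Op o x y z) s (upd s x (eval_binop o (s y) (s z)))
| exec_read x y s :
    ok (upd s x (read_input w (s y))) ->
    exec w ok (Read x y) s (upd s x (read_input w (s y)))
| exec_seq c1 c2 s s' s'' :
    exec w ok c1 s s' -> exec w ok c2 s' s'' -> exec w ok (Seq c1 c2) s s''
| exec_if_true x c1 c2 s s' :
    s x != 0 -> exec w ok c1 s s' -> exec w ok (If x c1 c2) s s'
| exec_if_false x c1 c2 s s' :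
    s x = 0 -> exec w ok c2 s s' -> exec w ok (If x c1 c2) s s'
| exec_while_true x c s s' s'' :
    s x != 0 -> exec w ok c s s' -> exec w ok (While x c) s' s'' ->
    exec w ok (While x c) s s''
| exec_while_false x c s :
    s x = 0 -> exec w ok (While x c) s s.

Definition init_store : store := fun=> 0.

(* Length of the binary expansion of m, with bitlen 0 = 1. *)
Definition bitlen (m : nat) : nat := (trunc_log 2 m).+1.

Definition space (c : cmd) (s : store) : nat := \sum_(i < width c) bitlen (s i).

Definition outputs (c : cmd) (w : seq bool) (v : nat) : Prop :=
  exists2 s, exec w predT c init_store s & s 0 = v.

Definition outputs_within (B : nat) (c : cmd) (w : seq bool) (v : nat) : Prop :=
  let ok := fun s => space c s <= B in
  ok init_store /\ exists2 s, exec w ok c init_store s & s 0 = v.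

(* Arguments are presented in unary. *)
Definition computable (f : nat -> nat) : Prop :=
  exists c, forall k, outputs c (nseq k true) (f k).

(** * Parameterized problems *)

(* An algorithm for a problem is only required to behave on the strings
   encoding an instance in [dom]. *)
Record problem := Problem {
  inst : Type;
  enc : inst -> seq bool;
  dom : inst -> Prop;
  yes : inst -> Prop;
  param : inst -> nat
}.

Definition computable_param (P : problem) : Prop :=
  exists c, forall x : inst P, dom x -> outputs c (enc x) (param x).

Definition solvable_in_space (P : problem) (B : inst P -> nat) : Prop :=
  exists c, forall x : inst P, dom x ->
    exists2 v, outputs_within (B x) c (enc x) v & v != 0 <-> yes x.

Definition para_L (P : problem) : Prop :=
  computable_param P /\
  exists f a, computable f /\
    solvable_in_space (fun x : inst P => f (param x) + a * bitlen (size (enc x))).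

Definition restrict (P : problem) (D : inst P -> Prop) : problem :=
  @Problem (inst P) (@enc P) (fun x => dom x /\ D x) (@yes P) (@param P).

(** * Graphs *)

Record sgraph := SGraph {
  vertex :> finType;
  adj : rel vertex;
  adj_sym : symmetric adj;
  adj_irr : irreflexive adj
}.

Definition iso (G H : sgraph) : Prop :=
  exists2 f : G -> H, bijective f & {mono f : x y / adj x y}.

Section Induced.
Variables (G : sgraph) (A : {set G}).

Definition induced_adj : rel {x : G | x \in A} :=
  fun x y => adj (val x) (val y).

Lemma induced_sym : symmetric induced_adj.
Proof. by move=> x y; apply: adj_sym. Qed.

Lemma induced_irr : irreflexive induced_adj.
Proof. by move=> x; apply: adj_irr. Qed.

Definition induced : sgraph := SGraph induced_sym induced_irr.
End Induced.

Definition del (G : sgraph) (S : {set G}) : sgraph := induced (~: S).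

Record graph_class := GraphClass {
  in_class :> sgraph -> Prop;
  in_class_iso : forall G H, iso G H -> in_class G -> in_class H
}.

Definition characterized_by (Psi : graph_class) (Phi : seq sgraph) : Prop :=
  forall G : sgraph, Psi G <->
    ~ exists (A : {set G}) (H : sgraph), List.In H Phi /\ iso (induced A) H.

(** * Vertex deletion *)

(* 1^k 0 1^|V| 0 followed by the adjacency matrix, row by row.  Unary k is
   harmless: it adds at most k to the length, and a term in k only is absorbed
   by the parameter-dependent part of the space bound. *)
Definition enc_graph (x : sgraph * nat) : seq bool :=
  let: (G, k) := x in
  nseq k true ++ false :: nseq #|G| true ++ false ::
  [seq adj u v | u <- enum G, v <- enum G].

Definition Del (Pi : graph_class) : problem :=
  @Problem (sgraph * nat) enc_graph (fun=> True)
    (fun x => exists S : {set x.1}, #|S| <= x.2 /\ Pi (del S))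
    snd.

Definition ResDel (Pi Psi : graph_class) : problem :=
  @restrict (Del Pi) (fun x => Psi x.1).

(* Main.v *)
Require Import Defs.
From mathcomp Require Import all_boot zify.

Set Implicit Arguments.
Unset Strict Implicit.
Unset Printing Implicit Defensive.

(** A set S of at most k vertices puts G in Psi iff it hits every tuple of
  vertices that induces a copy of a graph of Phi.  Since the tuples have bounded
  length, all inclusion-minimal such S live in a kernel of size bounded in k.
  Call a partial tuple forced when it is a copy itself or when, for some larger
  set of coordinates, more than a threshold in k of values of a new coordinate
  extend it to forced partial tuples that are minimal above it; by pigeonhole
  every hitting set of size at most k hits the forced partial tuples.  The kernel
  consists of the vertices of the minimal nonempty forced partial tuples.
  Membership in it is decided by a nest of counters of constant depth, hence with
  O(log n) bits.  A candidate S is then named by a bit mask over the kernel, whose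
  length depends on k only, so storing S explicitly (k log n bits) is avoided.
  For each mask with |S| <= k and G - S in Psi, the given algorithm is run on
  (G - S, k - |S|), the bits of that instance being recomputed on demand.

  Constant depth gives O(log n) bits because an arithmetic expression with
  bounded sums is evaluated with registers polynomial in its variables. *)

(** The recurrence for [threshold] comes from the pigeonhole step. If S, of size at most k, misses a
    partial tuple on s, every counted extension is hit at a coordinate outside s and can be charged
    to one of h * k pairs (coordinate, element of S). Fixing a pair enlarges s, and since counted
    extensions are minimal above s, the enlarged partial tuple is not forced; so the threshold one
    level down limits the values charged to the pair.

    The kernel depends on G and k alone, but its size bound is proved only when some S of size at
    most k hits all copies. Otherwise it may be large; cutting the masks off at the bound then loses
    nothing, since no mask can name an admissible S.

    Two obstacles lie in the definition of para-L. The given bound f need not be monotone, while the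
    algorithm is run with various parameters k - |S|; the sum of f over 0..k replaces it. And the
    new bound must itself be computable: the program for f is simulated on the inputs 1^j, by the
    simulator that also serves for G - S. *)

(** * Stores, executions and bit lengths *)

Lemma updE s x v y : upd s x v y = if y == x then v else s y.
Proof. by []. Qed.

Lemma upd_same s x v : upd s x v x = v.
Proof. by rewrite updE eqxx. Qed.

Lemma upd_other s x v y : y != x -> upd s x v y = s y.
Proof. by rewrite updE => /negPf->. Qed.

Lemma exec_weaken w (ok1 ok2 : pred store) c s s' :
  (forall s, ok1 s -> ok2 s) -> exec w ok1 c s s' -> exec w ok2 c s s'.
Proof.
move=> sub; elim=> {c s s'}; try by move=> *; constructor; auto.
- by move=> c1 c2 s s' s'' _ IH1 _ IH2; apply: exec_seq IH1 IH2.
- by move=> x c s s' s'' nz _ IH1 _ IH2; apply: exec_while_true nz IH1 IH2.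
Qed.

(** Runs are analysed through bounds on register values, which compose more easily than bit counts;
    [space_below] converts back at the very end. *)
Definition below (W B : nat) : pred store :=
  fun s => all (fun i => s i <= B) (iota 0 W).

Lemma belowP W B s : reflect (forall i, i < W -> s i <= B) (below W B s).
Proof.
apply: (iffP allP) => H i; last by rewrite mem_iota => /andP[_]; apply: H.
by move=> iW; apply: H; rewrite mem_iota.
Qed.

Lemma below_upd W B s x v : below W B s -> v <= B -> below W B (upd s x v).
Proof.
by move=> /belowP sB vB; apply/belowP=> i iW; rewrite updE; case: eqP; auto.
Qed.

Lemma below_mono W B B' s : B <= B' -> below W B s -> below W B' s.
Proof.
by move=> le /belowP sB; apply/belowP=> i /sB iB; apply: leq_trans le.
Qed.

Lemma below_ex W s : exists B, below W B s.
Proof.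
exists (\sum_(i < W) s i); apply/belowP=> i iW.
by rewrite (bigD1 (Ordinal iW)) //= leq_addr.
Qed.

(** Computability comes without any resource bound, yet the simulation needs one on the simulated
    registers. A finite run visits finitely many stores. *)
Lemma exec_bounded W w c s s' :
  exec w predT c s s' -> exists B, exec w (below W B) c s s'.
Proof.
have up B B' c1 s1 s2 :
    B <= B' -> exec w (below W B) c1 s1 s2 -> exec w (below W B') c1 s1 s2.
  by move=> le; apply: exec_weaken => t; apply: below_mono.
elim=> {c s s'}.
- by move=> s; exists 0; constructor.
- by move=> x m s _; have [B] := below_ex W (upd s x m); exists B; constructor.
- move=> o x y z s _.
  have [B] := below_ex W (upd s x (eval_binop o (s y) (s z))).
  by exists B; constructor.
- move=> x y s _.
  have [B] := below_ex W (upd s x (read_input w (s y))).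
  by exists B; constructor.
- move=> c1 c2 s s' s'' _ [B1 H1] _ [B2 H2]; exists (maxn B1 B2).
  by apply: exec_seq; [apply: up H1 | apply: up H2]; lia.
- by move=> x c1 c2 s s' nz _ [B H]; exists B; apply: exec_if_true.
- by move=> x c1 c2 s s' z _ [B H]; exists B; apply: exec_if_false.
- move=> x c s s' s'' nz _ [B1 H1] _ [B2 H2]; exists (maxn B1 B2).
  by apply: exec_while_true nz _ _; [apply: up H1 | apply: up H2]; lia.
- by move=> x c s z; exists 0; apply: exec_while_false.
Qed.

Lemma ltn_exp_bitlen m : m < 2 ^ bitlen m.
Proof. exact: trunc_log_ltn. Qed.

Lemma bitlen_le m e : m < 2 ^ e.+1 -> bitlen m <= e.+1.
Proof.
move=> lt; rewrite /bitlen ltnS; case: m lt => [|m] lt; first by rewrite trunc_log0.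
by rewrite -ltnS -(ltn_exp2l (m := 2)) //; apply: leq_ltn_trans lt; apply: trunc_logP.
Qed.

Lemma bitlen_mono m n : m <= n -> bitlen m <= bitlen n.
Proof. by move=> le; rewrite ltnS leq_trunc_log. Qed.

Lemma space_below W e c s :
  width c <= W -> below W (2 ^ e) s -> space c s <= W * e.+1.
Proof.
move=> cW /belowP sB; rewrite /space.
apply: (@leq_trans (\sum_(i < width c) e.+1)).
  apply: leq_sum => i _; apply: bitlen_le.
  apply: (@leq_ltn_trans (2 ^ e)); last by rewrite ltn_exp2l.
  by apply: sB; apply: leq_trans cW.
by rewrite sum_nat_const card_ord leq_mul2r cW orbT.
Qed.

(** Turns the space bound of the given algorithm into the value bound that the simulation asks
    for. *)
Lemma space_reg c s i : i < width c -> s i < 2 ^ space c s.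
Proof.
move=> iW; apply: leq_trans (ltn_exp_bitlen _) _; rewrite leq_exp2l //.
by rewrite /space (bigD1 (Ordinal iW)) //= leq_addr.
Qed.

(** * Arithmetic expressions with bounded sums *)

(** [EShr] is primitive because the power of two in its meaning may be far larger than the allowed
    register contents; it is executed by repeated halving, without ever forming the power. *)
Inductive expr :=
| EVar (i : nat)
| ECst (m : nat)
| EOp (o : binop) (a b : expr)
| ERead (a : expr)
| EShr (a b : expr)
| ESum (x : nat) (a b : expr).

Fixpoint eval (w : seq bool) (s : store) (e : expr) : nat :=
  match e with
  | EVar i => s i
  | ECst m => m
  | EOp o a b => eval_binop o (eval w s a) (eval w s b)
  | ERead a => read_input w (eval w s a)
  | EShr a b => eval w s a %/ 2 ^ eval w s b
  | ESum x a b => \sum_(i < eval w s a) eval w (upd s x i) b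
  end.

Fixpoint vbound (e : expr) : nat :=
  match e with
  | EVar i => i.+1
  | ECst _ => 0
  | EOp _ a b => maxn (vbound a) (vbound b)
  | ERead a => vbound a
  | EShr a b => maxn (vbound a) (vbound b)
  | ESum x a b => maxn x.+1 (maxn (vbound a) (vbound b))
  end.

Lemma eval_agree w r e s s' : vbound e <= r ->
  (forall i, i < r -> s i = s' i) -> eval w s e = eval w s' e.
Proof.
elim: e s s' => [i|m|o a IHa b IHb|a IHa|a IHa b IHb|x a IHa b IHb] s s' /=.
- by move=> ir; apply.
- by [].
- by rewrite geq_max => /andP[ha hb] E; rewrite (IHa s s') // (IHb s s').
- by move=> ha E; rewrite (IHa s s').
- by rewrite geq_max => /andP[ha hb] E; rewrite (IHa s s') // (IHb s s').
- rewrite !geq_max => /and3P[hx ha hb] E; rewrite (IHa s s') //.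
  by apply: eq_bigr => i _; apply: IHb => // j jr; rewrite !updE E.
Qed.

Lemma read_input_le2 w a : read_input w a <= 2.
Proof.
rewrite /read_input; case: (ltnP a (size w)) => [lt|ge].
  by rewrite (nth_map false) //; case: nth.
by rewrite nth_default // size_map.
Qed.

(** All intermediate results stay within [B]. Reads and shifts carry no clause for their own result:
    a read returns at most 2, and a shift never exceeds its first argument. *)
Fixpoint fits (B : nat) (w : seq bool) (s : store) (e : expr) : Prop :=
  match e with
  | EVar i => s i <= B
  | ECst m => m <= B
  | EOp o a b => [/\ fits B w s a, fits B w s b &
                     eval_binop o (eval w s a) (eval w s b) <= B]
  | ERead a => fits B w s a
  | EShr a b => fits B w s a /\ fits B w s b
  | ESum x a b =>
      [/\ fits B w s a, forall i, i < eval w s a -> fits B w (upd s x i) b &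
          \sum_(i < eval w s a) eval w (upd s x i) b <= B]
  end.

Lemma fits_agree B w r e s s' : vbound e <= r ->
  (forall i, i < r -> s' i = s i) -> fits B w s e -> fits B w s' e.
Proof.
elim: e s s' => [i|m|o a IHa b IHb|a IHa|a IHa b IHb|x a IHa b IHb] s s' /=.
- by move=> ir ->.
- by [].
- rewrite geq_max => /andP[ha hb] E [fa fb le].
  rewrite (eval_agree _ ha E) (eval_agree _ hb E).
  by split=> //; [apply: IHa fa | apply: IHb fb].
- exact: IHa.
- rewrite geq_max => /andP[ha hb] E [fa fb].
  by split; [apply: IHa fa | apply: IHb fb].
- rewrite !geq_max => /and3P[hx ha hb] E [fa fb le].
  have Eu i j : j < r -> upd s' x i j = upd s x i j by move=> jr; rewrite !updE E.
  rewrite (eval_agree _ ha E); split; first exact: IHa fa.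
    by move=> i /fb; apply: IHb (Eu i).
  apply: leq_trans le; rewrite leq_eqVlt; apply/orP; left; apply/eqP.
  by apply: eq_bigr => i _; apply: eval_agree hb (Eu i).
Qed.

Lemma fits_mono B B' w e s : B <= B' -> fits B w s e -> fits B' w s e.
Proof.
move=> le; elim: e s => [i|m|o a IHa b IHb|a IHa|a IHa b IHb|x a IHa b IHb] s /=.
- by move/leq_trans; apply.
- by move/leq_trans; apply.
- by case=> /IHa ? /IHb ? ?; split=> //; apply: leq_trans le.
- exact: IHa.
- by case=> /IHa ? /IHb.
- by case=> /IHa ? H ?; split; [|move=> i /H /IHb|apply: leq_trans le].
Qed.

Lemma fits_eval B w e s : 2 <= B -> fits B w s e -> eval w s e <= B.
Proof.
move=> B2; elim: e s => [i|m|o a _ b _|a _|a IHa b _|x a _ b _] s //=; try by case.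
- by move=> _; apply: leq_trans (read_input_le2 _ _) _.
- by case=> /IHa le _; apply: leq_trans (leq_div _ _) le.
Qed.

Lemma leq2_expn N D : 2 <= (N + 2) ^ D.+1.
Proof.
apply: (@leq_trans (2 ^ D.+1)); first by rewrite -{1}(expn1 2) leq_exp2l.
by rewrite leq_exp2r // leq_addl.
Qed.

(** Serves nested sums: a loop variable may already be as large as a power of [N + 2], and a bound
    polynomial in it must be polynomial in [N] again. *)
Lemma leq_addn2_expn N D E : (((N + 2) ^ D.+1) + 2) ^ E <= (N + 2) ^ (D.+2 * E).
Proof.
have base : (N + 2) ^ D.+1 + 2 <= (N + 2) ^ D.+2.
  by rewrite (expnS _ D.+1); move: (leq2_expn N D); nia.
by rewrite expnM; case: E => // E; rewrite leq_exp2r.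
Qed.

(* The exponent depends on the expression only, so the register contents have
   a bit length linear in that of the variables. *)
Lemma fits_poly e : exists D, forall w s N,
  (forall i, i < vbound e -> s i <= N) -> fits ((N + 2) ^ D.+1) w s e.
Proof.
have up N D D' : D <= D' -> (N + 2) ^ D <= (N + 2) ^ D' by rewrite leq_exp2l // addn2.
elim: e => [i|m|o a [Da IHa] b [Db IHb]|a [D IHa]|a [Da IHa] b [Db IHb]|x a [Da IHa] b [Db IHb]] /=.
- by exists 0 => w s N H; apply: leq_trans (H i _) _; rewrite // expn1 leq_addr.
(* The exponent may depend on the constant itself, and [m < 2 ^ m]. *)
- exists m => w s N _; apply: leq_trans (up _ m _ _) => //.
  apply: (@leq_trans (2 ^ m)); first by rewrite ltnW // ltn_expl.
  by case: m => // m; rewrite leq_exp2r // leq_addl.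
- exists (Da + Db.+1) => w s N H.
  have fa := IHa w s N (fun i lt => H i (leq_trans lt (leq_maxl _ _))).
  have fb := IHb w s N (fun i lt => H i (leq_trans lt (leq_maxr _ _))).
  split; [by apply: fits_mono fa; apply: up; lia | by apply: fits_mono fb; apply: up; lia |].
  have := fits_eval (leq2_expn _ _) fa; have := fits_eval (leq2_expn _ _) fb.
  rewrite -addSn expnD; move: (leq2_expn N Da) (leq2_expn N Db).
  set X := _ ^ _; set Y := _ ^ _ => X2 Y2.
  set u := eval _ _ a; set v := eval _ _ b => vY uX; case: o => /=.
  + by nia.
  + by nia.
  + by rewrite leq_mul.
  + by apply: leq_trans (leq_div _ _) _; nia.
  + by apply: leq_trans (leq_mod _ _) _; nia.
- by exists D => w s N H; apply: IHa.
- exists (maxn Da Db) => w s N H; split.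
    apply: fits_mono (IHa w s N (fun i lt => H i (leq_trans lt (leq_maxl _ _)))).
    by apply: up; lia.
  apply: fits_mono (IHb w s N (fun i lt => H i (leq_trans lt (leq_maxr _ _)))).
  by apply: up; lia.
(* There are at most [N1 = (N + 2) ^ Da.+1] summands, each at most [(N1 + 2) ^ Db.+1]; their sum is
   below [(N1 + 2) ^ Db.+2], so the exponents multiply. *)
- exists (Da.+2 * Db.+2) => w s N H.
  have fa := IHa w s N (fun i lt => H i (leq_trans lt (leq_trans (leq_maxl _ _) (leq_maxr _ _)))).
  have va := fits_eval (leq2_expn _ _) fa.
  set N1 := (N + 2) ^ Da.+1 in fa va *.
  have fb i : i < eval w s a -> fits ((N1 + 2) ^ Db.+1) w (upd s x i) b.
    move=> lt; apply: IHb => j lj; rewrite updE; case: eqP => _; first by lia.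
    apply: (@leq_trans N); first by apply: H; lia.
    by apply: leq_trans (leq_addr 2 N) _; rewrite -{1}(expn1 (N + 2)); apply: up.
  have le : (N1 + 2) ^ Db.+2 <= (N + 2) ^ (Da.+2 * Db.+2).+1.
    by apply: leq_trans (leq_addn2_expn _ _ _) _; apply: up.
  split.
  + by apply: fits_mono fa; apply: up; nia.
  + move=> i /fb; apply: fits_mono; apply: leq_trans le.
    by rewrite leq_exp2l // addn2.
  + apply: leq_trans le; apply: (@leq_trans (\sum_(i < eval w s a) (N1 + 2) ^ Db.+1)).
      by apply: leq_sum => i _; apply: fits_eval (leq2_expn _ _) (fb i (ltn_ord i)).
    by rewrite sum_nat_const card_ord [in leqRHS]expnS leq_mul2r; apply/orP; right; lia.
Qed.

(** * Compiling expressions to programs *)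

(** [I j] is the invariant with [j] iterations left, so [j] also serves as the termination
    measure. *)
Lemma exec_while w ok (I : nat -> store -> Prop) x c :
    (forall s, I 0 s -> s x = 0) ->
    (forall j s, I j.+1 s -> s x != 0 /\ exists2 s', exec w ok c s s' & I j s') ->
  forall j s, I j s -> exists2 s', exec w ok (While x c) s s' & I 0 s'.
Proof.
move=> I0 IS; elim=> [|j IH] s Is.
  by exists s => //; apply: exec_while_false; apply: I0.
have [nz [s1 r1 I1]] := IS j s Is; have [s2 r2 I2] := IH _ I1.
by exists s2 => //; apply: exec_while_true nz r1 r2.
Qed.

Definition copy (x y : nat) : cmd := Seq (Const x 0) (Op Add x x y).

Definition halve_step (r : nat) : cmd :=
  Seq (Seq (Const r.+2 2) (Op Div r r r.+2))
      (Seq (Const r.+2 1) (Op Defs.Sub r.+1 r.+1 r.+2)).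

(** The register [x] counts down and is at once loop counter and summation index. [r] accumulates,
    [r.+1] keeps the former value of [x], and the registers from [r.+2] on are free for the body. *)
Definition sum_step (body : cmd) (x r : nat) : cmd :=
  Seq (Seq (Const r.+2 1) (Op Defs.Sub x x r.+2)) (Seq body (Op Add r r r.+2)).

(* The result is left in register r and registers below r are preserved. *)
Fixpoint compile (e : expr) (r : nat) : cmd :=
  match e with
  | EVar i => copy r i
  | ECst m => Const r m
  | EOp o a b => Seq (compile a r) (Seq (compile b r.+1) (Op o r r r.+1))
  | ERead a => Seq (compile a r) (Read r r)
  | EShr a b =>
      Seq (compile a r) (Seq (compile b r.+1)
        (While r.+1 (halve_step r)))
  | ESum x a b =>
      Seq (compile a r.+2) (Seq (copy r.+1 x) (Seq (copy x r.+2) (Seq (Const r 0)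
        (Seq (While x (sum_step (compile b r.+2) x r))
             (copy x r.+1)))))
  end.

Ltac bounds_lia :=
  repeat match goal with H : ?T |- _ =>
    lazymatch T with
    | is_true (leq _ _) => fail
    | is_true (~~ (_ == _)) => fail
    | nat => fail
    | _ => clear H
    end end; lia.

Ltac upd_simpl :=
  rewrite ?updE ?eqxx;
  repeat match goal with |- context [@eq_op _ ?a ?b] =>
    let H := fresh in
    first [have H : (a == b) = false by bounds_lia
          |have H : (a == b) = true by bounds_lia];
    rewrite H; clear H end.

Section Execution.
Variables (w : seq bool) (W B : nat).
Hypothesis B2 : 2 <= B.
Local Notation ok := (below W B).
Local Notation run := (exec w ok).

Lemma run_op o x y z s : ok s -> eval_binop o (s y) (s z) <= B ->
  run (Op o x y z) s (upd s x (eval_binop o (s y) (s z))).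
Proof. by move=> sB vB; constructor; apply: below_upd. Qed.

Lemma run_const x m s : ok s -> m <= B -> run (Const x m) s (upd s x m).
Proof. by move=> sB mB; constructor; apply: below_upd. Qed.

Lemma run_copy x y s : y != x -> ok s -> s y <= B -> exists s',
  [/\ run (copy x y) s s', ok s' & s' =1 upd s x (s y)].
Proof.
move=> yx sB vB; have s1B : ok (upd s x 0) by apply: below_upd.
have E : eval_binop Add (upd s x 0 x) (upd s x 0 y) = s y.
  by rewrite /= upd_same add0n upd_other.
exists (upd (upd s x 0) x (s y)); split.
- apply: (exec_seq (s' := upd s x 0)); first exact: run_const.
  by rewrite -E; apply: run_op; rewrite ?E.
- exact: below_upd.
- by move=> i; rewrite !updE; case: eqP.
Qed.

Lemma run_halve r j s : ok s -> s r.+1 = j -> s r <= B -> j <= B ->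
  exists s', [/\ run (While r.+1 (halve_step r)) s s', ok s',
                 s' r = s r %/ 2 ^ j & forall i, i < r -> s' i = s i].
Proof.
elim: j s => [|j IH] t okt tj tB jB.
  by exists t; rewrite divn1; split=> //; apply: exec_while_false.
pose t1 := upd t r.+2 2; pose t2 := upd t1 r (t r %/ 2).
pose t3 := upd t2 r.+2 1; pose t4 := upd t3 r.+1 j.
have hB : t r %/ 2 <= B by apply: leq_trans (leq_div _ _) _.
have E2 : eval_binop Div (t1 r) (t1 r.+2) = t r %/ 2 by rewrite /= /t1; upd_simpl.
have E4 : eval_binop Defs.Sub (t3 r.+1) (t3 r.+2) = j.
  by rewrite /= /t3 /t2 /t1; upd_simpl; rewrite tj subn1.
have k1 : ok t1 by apply: below_upd.
have k2 : ok t2 by apply: below_upd.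
have k3 : ok t3 by apply: below_upd => //; bounds_lia.
have k4 : ok t4 by apply: below_upd => //; bounds_lia.
have [||||s' [r4 ok' v p]] := IH t4 => //; first exact: upd_same.
- by rewrite /t4 /t3 /t2; upd_simpl.
- by bounds_lia.
exists s'; split=> //.
- apply: exec_while_true r4; first by rewrite tj.
  apply: (exec_seq (s' := t2));
    [apply: (exec_seq (s' := t1)) | apply: (exec_seq (s' := t3))];
    try by apply: run_const => //; bounds_lia.
  + by rewrite /t2 -E2; constructor; rewrite E2.
  + by rewrite /t4 -E4; constructor; rewrite E4.
- rewrite v expnS divnMA; congr (_ %/ _).
  by rewrite /t4 /t3 /t2; upd_simpl.
- by move=> i ir; rewrite p // /t4 /t3 /t2 /t1; upd_simpl.
Qed.

Lemma run_compile e r s : vbound e <= W -> vbound e <= r -> fits B w s e -> ok s ->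
  exists s', [/\ run (compile e r) s s', ok s', s' r = eval w s e &
                 forall i, i < r -> s' i = s i].
Proof.
elim: e r s => [i|m|o a IHa b IHb|a IHa|a IHa b IHb|x a IHa b IHb] r s /=.
- move=> _ ir sB okB; have [|s' [r1 ok1 E]] := run_copy (x := r) _ okB sB; first by bounds_lia.
  by exists s'; split=> // [|j jr]; rewrite E; upd_simpl.
- move=> _ _ mB okB; exists (upd s r m); split; first exact: run_const.
  + exact: below_upd.
  + exact: upd_same.
  + by move=> i ir; rewrite upd_other //; bounds_lia.
- rewrite !geq_max => /andP[aW bW] /andP[ar br] [fa fb vB] okB.
  have [s1 [r1 ok1 v1 p1]] := IHa r s aW ar fa okB.
  have [s2 [r2 ok2 v2 p2]] := IHb r.+1 s1 bW (leqW br) (fits_agree br p1 fb) ok1.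
  have E : eval_binop o (s2 r) (s2 r.+1) = eval_binop o (eval w s a) (eval w s b).
    by rewrite v2 (p2 r) // v1 (eval_agree _ br p1).
  exists (upd s2 r (eval_binop o (eval w s a) (eval w s b))); split.
  + by apply: exec_seq r1 _; apply: exec_seq r2 _; rewrite -E; apply: run_op; rewrite ?E.
  + exact: below_upd.
  + exact: upd_same.
  + by move=> i ir; rewrite upd_other ?p2 ?p1 //; bounds_lia.
- move=> aW ar fa okB; have [s1 [r1 ok1 v1 p1]] := IHa r s aW ar fa okB.
  have ok2 : ok (upd s1 r (read_input w (s1 r))).
    by apply: below_upd => //; apply: leq_trans (read_input_le2 _ _) _.
  exists (upd s1 r (read_input w (s1 r))); split=> //.
  + by apply: exec_seq r1 _; constructor.
  + by rewrite upd_same v1.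
  + by move=> i ir; rewrite upd_other ?p1 //; bounds_lia.
- rewrite !geq_max => /andP[aW bW] /andP[ar br] [fa fb] okB.
  have [s1 [r1 ok1 v1 p1]] := IHa r s aW ar fa okB.
  have [s2 [r2 ok2 v2 p2]] := IHb r.+1 s1 bW (leqW br) (fits_agree br p1 fb) ok1.
  have aB : eval w s a <= B by apply: fits_eval fa.
  have bB : eval w s b <= B by apply: fits_eval fb.
  have s2r : s2 r = eval w s a by rewrite p2.
  have s2r1 : s2 r.+1 = eval w s b by rewrite v2 (eval_agree _ br p1).
  have aB' : s2 r <= B by rewrite s2r.
  have [s3 [r3 ok3 v3 p3]] := run_halve ok2 s2r1 aB' bB.
  exists s3; split=> //; last by move=> i ir; rewrite p3 ?p2 ?p1 //; bounds_lia.
    by apply: exec_seq r1 _; apply: exec_seq r2 _.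
  by rewrite v3 s2r.
- rewrite !geq_max => /and3P[xW aW bW] /and3P[xr ar br] [fa fb vB] okB.
  have [s1 [r1 ok1 v1 p1]] := IHa r.+2 s aW (leqW (leqW ar)) fa okB.
  have aB : eval w s a <= B by apply: fits_eval fa.
  have s1x : s1 x = s x by apply: p1; bounds_lia.
  (* The old content of the loop register gets saved, so it has to be bounded although the
     expression may never use it. This is where [vbound e <= W] matters. *)
  have xB : s1 x <= B by move/belowP: ok1; apply.
  have [|s2 [r2 ok2 E2]] := run_copy (x := r.+1) (y := x) _ ok1 xB; first by bounds_lia.
  have s2r : s2 r.+2 = eval w s a by rewrite E2; upd_simpl.
  have [||s3 [r3 ok3 E3]] := run_copy (x := x) (y := r.+2) (s := s2) _ ok2 _; rewrite ?s2r //;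
    first by bounds_lia.
  pose s4 := upd s3 r 0; have ok4 : ok s4 by apply: below_upd.
  (* [F j] is the accumulator once the indices from [j] upwards have been added, as the loop counts
     down. The existential keeps it opaque. *)
  have [F FE] : exists F : nat -> nat, forall j,
      F j = \sum_(j <= i < eval w s a) eval w (upd s x i) b by eexists.
  have F0 : \sum_(i < eval w s a) eval w (upd s x i) b = F 0.
    by rewrite FE -(big_mkord xpredT (fun i => eval w (upd s x i) b)).
  have FL : F (eval w s a) = 0 by rewrite FE big_geq.
  have FS j : j < eval w s a -> F j = F j.+1 + eval w (upd s x j) b.
    by move=> lt; rewrite !FE big_ltn // addnC.
  have FB j : j <= eval w s a -> F j <= B.
    move=> le; apply: leq_trans vB; rewrite F0 !FE.
    by rewrite (@big_cat_nat _ _ _ j 0) //= leq_addl.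
  rewrite F0 in vB *; move: (eval w s a) aB fb s2r FL FS FB {F0 FE fa} => L LB fb s2r FL FS FB.
  pose I j t := ok t /\ [/\ t x = j, j <= L, t r = F j,
    t r.+1 = s x & forall i, i < r -> i != x -> t i = s i].
  have I4 : I L s4.
    rewrite /I /s4 FL; split=> //; split=> //; first by upd_simpl; rewrite E3 upd_same.
    + by upd_simpl.
    + by upd_simpl; rewrite E3; upd_simpl; rewrite E2; upd_simpl.
    + by move=> i ir ix; upd_simpl; rewrite E3; upd_simpl; rewrite E2; upd_simpl;
         apply: p1; bounds_lia.
  have [|j t [okt [tx ja tr tr1 ti]]|s5 r5 [ok5 [x5 _ E5 q5 p5]]] :=
    exec_while (w := w) (ok := ok) (I := I) (x := x) (c := sum_step (compile b r.+2) x r) _ _ I4.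
  + by move=> t [_ []].
  + split; first by rewrite tx.
    pose t1 := upd t r.+2 1; pose t2 := upd t1 x j.
    have k1 : ok t1 by apply: below_upd => //; bounds_lia.
    have k2 : ok t2 by apply: below_upd => //; bounds_lia.
    have t2s i : i < r -> t2 i = upd s x j i.
      move=> ir; rewrite /t2 /t1 !updE; case: eqP => // /eqP ix.
      by upd_simpl; apply: ti.
    have fb2 : fits B w t2 b by apply: fits_agree br t2s _; apply: fb.
    have [t3 [q3 k3 v3 p3]] := IHb r.+2 t2 bW (leqW (leqW br)) fb2 k2.
    have b3 : t3 r.+2 = eval w (upd s x j) b by rewrite v3 (eval_agree _ br t2s).
    have t3r : t3 r = t r.
      by rewrite p3 ?leqnSn // /t2 /t1; upd_simpl.
    have acc : t3 r + t3 r.+2 = F j by rewrite t3r tr b3 -FS.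
    have accB : t3 r + t3 r.+2 <= B by rewrite acc; apply: FB; bounds_lia.
    exists (upd t3 r (t3 r + t3 r.+2)); last first.
    * split; first exact: below_upd.
      rewrite !updE eqxx acc; split=> //; try by apply: ltnW.
      - by upd_simpl; rewrite p3 ?t2s ?upd_same //; bounds_lia.
      - by rewrite p3 // /t2 /t1 -tr1; upd_simpl.
      - move=> i ir ix; rewrite upd_other; last by bounds_lia.
        by rewrite p3 ?t2s ?upd_other //; bounds_lia.
    apply: (exec_seq (s' := t2)); last by apply: exec_seq q3 _; apply: (@run_op Add).
    apply: (exec_seq (s' := t1)); first by apply: run_const => //; bounds_lia.
    suff -> : t2 = upd t1 x (eval_binop Defs.Sub (t1 x) (t1 r.+2)).
      apply: run_op => //=; apply: leq_trans (leq_subr _ _) _.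
      by rewrite /t1; upd_simpl; rewrite tx; bounds_lia.
    by rewrite /= /t2 /t1; upd_simpl; rewrite tx subn1.
  + have x5B : s5 r.+1 <= B by rewrite q5 -s1x.
    have [|s6 [r6 ok6 E6]] := run_copy (x := x) (y := r.+1) _ ok5 x5B; first by bounds_lia.
    exists s6; split=> //.
    * apply: exec_seq r1 _; apply: exec_seq r2 _; apply: exec_seq r3 _.
      by apply: exec_seq (run_const _ ok3 _) _ => //; apply: exec_seq r5 r6.
    * by rewrite E6 -E5; upd_simpl.
    * by move=> i ir; rewrite E6 updE; case: eqP => [->|/eqP ix]; [rewrite q5 | apply: p5].
Qed.
End Execution.

(** * Simulating a program on a computed input *)

Definition assign (R x : nat) (e : expr) : cmd := Seq (compile e R) (copy x R).

(* Register V + x of the simulation plays the role of register x; the expression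
   rd computes the bit of the simulated input whose address is in register a. *)
Fixpoint sim (R V a : nat) (rd : expr) (c : cmd) : cmd :=
  match c with
  | Skip => Skip
  | Const x m => Const (V + x) m
  | Op o x y z => Op o (V + x) (V + y) (V + z)
  | Read x y => Seq (copy a (V + y)) (assign R (V + x) rd)
  | Seq c1 c2 => Seq (sim R V a rd c1) (sim R V a rd c2)
  | If x c1 c2 => If (V + x) (sim R V a rd c1) (sim R V a rd c2)
  | While x c1 => While (V + x) (sim R V a rd c1)
  end.

(** A simulated program starts from the zero store, whereas its block of registers still holds the
    remains of the previous simulation. *)
Fixpoint clear_regs (V n : nat) : cmd :=
  if n is n'.+1 then Seq (clear_regs V n') (Const (V + n') 0) else Skip.

Section Simulation.
Variables (w : seq bool) (W B N R : nat).
Hypotheses (N2 : 2 <= N) (NB : N <= B) (RW : R <= W).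
Local Notation run := (exec w (below W B)).

(** Two levels of bounds: [N] for what persists between assignments, in the registers below [R], and
    the larger [B] for the temporaries of expression evaluation. *)
Definition good (s : store) := (forall i, i < R -> s i <= N) /\ below W B s.

Definition admissible (e : expr) := vbound e <= R /\
  forall s, (forall i, i < R -> s i <= N) -> fits B w s e.

Lemma good_upd s x v : good s -> v <= N -> good (upd s x v).
Proof.
move=> [sN sB] vN; split; last by apply: below_upd => //; apply: leq_trans NB.
by move=> i iR; rewrite updE; case: eqP; auto.
Qed.

Lemma run_assign x e s : x < R -> good s -> admissible e -> eval w s e <= N ->
  exists s', [/\ run (assign R x e) s s', good s' &
    forall i, i < R -> s' i = upd s x (eval w s e) i].
Proof.
move=> xR [sN sB] [eR ef] eN; have B2 : 2 <= B by apply: leq_trans NB.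
have [s1 [r1 ok1 v1 p1]] := run_compile B2 (leq_trans eR RW) eR (ef s sN) sB.
have v1B : s1 R <= B by rewrite v1; apply: leq_trans NB.
have [|s2 [r2 ok2 E2]] := run_copy w (x := x) (y := R) (s := s1) _ ok1 v1B.
  by bounds_lia.
have p2 i : i < R -> s2 i = upd s x (eval w s e) i.
  by move=> iR; rewrite E2 v1 !updE p1.
exists s2; split=> //; first exact: exec_seq r1 r2.
by split=> // i iR; rewrite p2 // updE; case: eqP; auto.
Qed.

Lemma run_clear V n s : V + n <= R -> good s -> exists s',
  [/\ run (clear_regs V n) s s', good s', forall i, i < n -> s' (V + i) = 0 &
      forall i, i < V -> s' i = s i].
Proof.
elim: n s => [|n IH] s /= nR gs; first by exists s; split=> //; constructor.
have [|s1 [r1 g1 z1 p1]] := IH s _ gs; first by bounds_lia.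
have g2 : good (upd s1 (V + n) 0) by apply: good_upd.
exists (upd s1 (V + n) 0); split=> //.
- by apply: exec_seq r1 _; constructor; case: g2.
- move=> i; rewrite updE eqn_add2l; case: eqP => // /eqP ne lt.
  by apply: z1; rewrite ltn_neqAle ne.
- by move=> i iV; rewrite -p1 //; upd_simpl.
Qed.

Variables (w' : seq bool) (ok' : pred store) (V a Wc : nat) (rd : expr) (t : store).
Hypotheses (VR : V + Wc <= R) (aV : a < V) (rd_adm : admissible rd).
Hypothesis ok'N : forall s, ok' s -> forall i, i < Wc -> s i <= N.
Hypothesis rdE : forall s, good s -> (forall i, i < V -> i != a -> s i = t i) ->
  eval w s rd = read_input w' (s a).

(** Register [a] is exempt from the frame condition because every simulated read overwrites it with
    an address. *)
Definition simulates (s s1 : store) :=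
  (forall i, i < Wc -> s1 (V + i) = s i) /\ (forall i, i < V -> i != a -> s1 i = t i).

Lemma simulates_upd s s1 s2 x v : x < Wc -> simulates s s1 ->
    (forall i, i < V + Wc -> i != a -> s2 i = upd s1 (V + x) v i) ->
  simulates (upd s x v) s2.
Proof.
move=> xW [m1 m2] E; split=> i iV.
  by rewrite E ?updE ?eqn_add2l ?m1 //; bounds_lia.
by move=> ia; rewrite E -?m2 //; [upd_simpl | bounds_lia].
Qed.

Lemma run_sim c s s' s1 : exec w' ok' c s s' -> width c <= Wc ->
  good s1 -> simulates s s1 ->
  exists s1', [/\ run (sim R V a rd c) s1 s1', good s1' & simulates s' s1'].
Proof.
move=> H; elim: H s1 => {c s s'} /=.
- by move=> s s1 _ g m; exists s1; split=> //; constructor.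
- move=> x m s ok1 s1 xW g mt.
  have mN : m <= N by rewrite -(upd_same s x m); apply: ok'N.
  have g' : good (upd s1 (V + x) m) by apply: good_upd.
  exists (upd s1 (V + x) m); split=> //; first by constructor; case: g'.
  exact: simulates_upd mt _.
- move=> o x y z s ok1 s1; rewrite !geq_max => /and3P[xW yW zW] g mt.
  have [m1 _] := mt; rewrite -!m1 // in ok1 *.
  set v := eval_binop _ _ _ in ok1 *.
  have vN : v <= N by rewrite -(upd_same s x v); apply: ok'N.
  have g' : good (upd s1 (V + x) v) by apply: good_upd.
  exists (upd s1 (V + x) v); split=> //; first by constructor; case: g'.
  exact: simulates_upd mt _.
- move=> x y s ok1 s1; rewrite geq_max => /andP[xW yW] g mt.
  have [m1 m2] := mt; rewrite -!m1 // in ok1 *.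
  have B2 : 2 <= B by apply: leq_trans NB.
  have yN : s1 (V + y) <= N by case: g => g _; apply: g; bounds_lia.
  have yB := leq_trans yN NB; have [_ ok_s1] := g.
  have [|s2 [r2 ok2 E2]] := run_copy w (x := a) (y := V + y) _ ok_s1 yB.
    by bounds_lia.
  have g2 : good s2.
    by split=> // i iR; rewrite E2 updE; case: eqP => // _; case: g => g _; apply: g.
  have ev : eval w s2 rd = read_input w' (s1 (V + y)).
    rewrite rdE ?E2 ?upd_same // => i iV ia; rewrite E2 -m2 //.
    exact: upd_other.
  have evN : eval w s2 rd <= N by rewrite ev; apply: leq_trans (read_input_le2 _ _) _.
  have [|s3 [r3 g3 E3]] := run_assign (x := V + x) _ g2 rd_adm evN; first by bounds_lia.
  exists s3; split=> //; first exact: exec_seq r2 r3.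
  apply: simulates_upd mt _ => // i iV ia; rewrite E3 ?ev; last by bounds_lia.
  by rewrite !updE E2 upd_other.
- move=> c1 c2 s s' s'' _ IH1 _ IH2 s1; rewrite geq_max => /andP[W1 W2] g m.
  have [s2 [r2 g2 m2]] := IH1 _ W1 g m; have [s3 [r3 g3 m3]] := IH2 _ W2 g2 m2.
  by exists s3; split=> //; apply: exec_seq r2 r3.
- move=> x c1 c2 s s' nz _ IH s1; rewrite !geq_max => /and3P[xW W1 W2] g m.
  have [s2 [r2 g2 m2]] := IH _ W1 g m; exists s2; split=> //.
  by apply: exec_if_true r2; case: m => -> .
- move=> x c1 c2 s s' nz _ IH s1; rewrite !geq_max => /and3P[xW W1 W2] g m.
  have [s2 [r2 g2 m2]] := IH _ W2 g m; exists s2; split=> //.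
  by apply: exec_if_false r2; case: m => -> .
- move=> x c s s' s'' nz _ IH1 _ IH2 s1 W0 g m.
  have /andP[xW W1] : (x < Wc) && (width c <= Wc) by rewrite -geq_max.
  have [s2 [r2 g2 m2]] := IH1 _ W1 g m; have [s3 [r3 g3 m3]] := IH2 _ W0 g2 m2.
  by exists s3; split=> //; apply: exec_while_true r2 r3; case: m => -> .
- move=> x c s z s1; rewrite geq_max => /andP[xW W1] g m.
  by exists s1; split=> //; apply: exec_while_false; case: m => -> .
Qed.

Lemma run_sim_init c s' s1 : exec w' ok' c init_store s' -> width c <= Wc ->
    good s1 -> (forall i, i < V -> i != a -> s1 i = t i) ->
  exists s1', [/\ run (Seq (clear_regs V Wc) (sim R V a rd c)) s1 s1', good s1'
                & simulates s' s1'].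
Proof.
move=> H cW g st; have [s2 [r2 g2 z2 p2]] := run_clear VR g.
have [|s3 [r3 g3 m3]] := run_sim H cW g2 _.
  by split=> // i iV ia; rewrite p2 ?st.
by exists s3; split=> //; apply: exec_seq r2 r3.
Qed.
End Simulation.

(** * A kernel for hitting sets of tuples *)

Section Kernel.
Variables (T : finType) (h k : nat) (E : pred {ffun 'I_h -> T}).
Implicit Types (s t r : {set 'I_h}) (x y : {ffun 'I_h -> T}).

(** [m] is the number of coordinates still undefined. The factor [h * k] counts pairs of a
    coordinate and an element of a hitting set; the successor is the charge allowed to each pair. *)
Fixpoint threshold (m : nat) : nat :=
  if m is m'.+1 then h * k * (threshold m').+1 else 0.

Definition agree_on s x y := [forall i in s, x i == y i].

Definition live_for (Q : {set 'I_h} -> pred {ffun 'I_h -> T}) s t y :=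
  Q t y && [forall r : {set 'I_h}, (s \proper r) && (r \proper t) ==> ~~ Q r y].

Definition values_for (Q : {set 'I_h} -> pred {ffun 'I_h -> T}) s x (p : {set 'I_h} * 'I_h) :=
  [set v | [exists y, [&& agree_on s x y, y p.2 == v & live_for Q s p.1 y]]].

Definition branches s : pred ({set 'I_h} * 'I_h) :=
  fun p => (s \proper p.1) && (p.2 \in p.1 :\: s).

Fixpoint forced_rec (m : nat) s x : bool :=
  if s == setT then E x else
  if m is m'.+1 then
    [exists p, branches s p &&
       (threshold (h - #|s|) < #|values_for (forced_rec m') s x p|)]
  else false.

Lemma values_for_eq (Q Q' : {set 'I_h} -> pred {ffun 'I_h -> T}) s x p :
  (forall t y, s \proper t -> Q t y = Q' t y) -> branches s p ->
  values_for Q s x p = values_for Q' s x p.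
Proof.
move=> QQ' /andP[sp _]; apply/setP=> v; rewrite !inE; apply: eq_existsb => y.
rewrite /live_for QQ' //; do 3 congr (_ && _); apply: eq_forallb => r.
by case: (boolP (s \proper r)) => //= sr; rewrite QQ'.
Qed.

Lemma proper_setT_gt s t : s \proper t -> h - #|t| < h - #|s|.
Proof.
move=> /proper_card lt; have := max_card (mem t); rewrite card_ord.
by move: lt; set a := #|_|; set b := #|_|; lia.
Qed.

(** Every recursive call concerns a strictly larger set of coordinates, so the number of undefined
    coordinates is enough fuel. *)
Lemma forced_rec_fuel m m' s x : h - #|s| <= m -> h - #|s| <= m' ->
  forced_rec m s x = forced_rec m' s x.
Proof.
have full (u : {set 'I_h}) : h - #|u| <= 0 -> u == [set: 'I_h].
  by move=> le; rewrite -subTset -setD_eq0 setTD -cards_eq0 cardsCs setCK card_ord -leqn0.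
elim: m m' s x => [|m IH] [|m'] s x //=.
- by move=> /full->.
- by move=> _ /full->.
move=> lm lm'; case: ifP => // _; apply: eq_existsb => p.
case: (boolP (branches s p)) => //= bp.
rewrite (@values_for_eq (forced_rec m) (forced_rec m')) // => t y.
by move=> /proper_setT_gt lt; apply: IH; rewrite -ltnS;
  [apply: leq_trans lt lm | apply: leq_trans lt lm'].
Qed.

(* Partial tuples, given by x and the set s of its defined coordinates, that
   every small hitting set of E must hit. *)
Definition forced := forced_rec h.

Definition live := live_for forced.
Definition values := values_for forced.

Lemma forcedT x : forced setT x = E x.
Proof.
have E1 m : forced_rec m setT x = E x by case: m => [|m] /=; rewrite eqxx.
exact: E1.
Qed.

Lemma forcedE s x : s != setT -> forced s x =
  [exists p, branches s p && (threshold (h - #|s|) < #|values s x p|)].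
Proof.
move=> sT; have lt : h - #|s| <= h by apply: leq_subr.
rewrite /forced (@forced_rec_fuel h h.+1) //=; last exact: leqW.
by rewrite (negPf sT).
Qed.

Lemma card_bigcup_le (I : finType) (P : pred I) (F : I -> {set T}) b :
  (forall i, P i -> #|F i| <= b) -> #|\bigcup_(i | P i) F i| <= #|P| * b.
Proof.
move=> Fb; rewrite -sum_nat_const.
elim/big_rec2: _ => [|i A n Pi IH]; first by rewrite cards0.
by apply: leq_trans (leq_card_setU _ _) _; apply: leq_add; rewrite ?Fb.
Qed.

Variable S : {set T}.
Hypothesis S_small : #|S| <= k.
Hypothesis S_hits : forall x, E x -> [exists i, x i \in S].

Lemma values_le s x p : s != setT -> ~~ forced s x -> branches s p ->
  #|values s x p| <= threshold (h - #|s|).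
Proof.
move=> sT; rewrite forcedE // negb_exists => /forallP/(_ p) + bp.
by rewrite bp -leqNgt.
Qed.

Lemma forced_hit s x : forced s x -> [exists i in s, x i \in S].
Proof.
have [n] := ubnP (h - #|s|); elim: n s x => // n IH s x lt.
have [->|sT] := eqVneq s setT.
  by rewrite forcedT => /S_hits/existsP[i xi]; apply/existsP; exists i; rewrite inE.
rewrite forcedE // => /existsP[[t j] /andP[bp]]; apply: contraLR => miss.
have /andP[/= st] := bp; rewrite inE => /andP[js jt].
have sn : 0 < h - #|s|.
  by have := @proper_setT_gt s setT; rewrite properT => /(_ sT); apply: leq_ltn_trans.
(* The values to be charged to a pair of a new coordinate and an element of [S]. *)
pose F (q : 'I_h * T) := [set v | [exists y, [&& agree_on s x y, y j == v,
  live s t y, q.1 \in t :\: s & y q.1 == q.2]]].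
have F_small q : #|F q| <= (threshold (h - #|s|).-1).+1.
  (* If the coordinate is [j] itself, the only possible value is [a]; the successor in [threshold]
     leaves room for it even when the lower threshold is 0. *)
  case: q => i a; have [ij|ij] := eqVneq i j.
    apply: (@leq_trans #|[set a]|); last by rewrite cards1.
    apply: subset_leq_card; apply/subsetP=> v; rewrite !inE /= ij.
    by case/existsP=> y /and5P[_ /eqP-> _ _ /eqP->].
  have [->|[v]] := set_0Vmem (F (i, a)); first by rewrite cards0.
  rewrite !inE => /existsP[y /and5P[/= xy _ /andP[ty /forallP lv] /andP[is_ it] /eqP yi]].
  pose r := i |: s.
  have sr : s \proper r by rewrite properUr // sub1set.
  have jr : j \notin r by rewrite !inE negb_or eq_sym ij.
  have rt : r \proper t.
    rewrite properE subUset sub1set it (proper_sub st) /=.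
    by apply/subsetPn; exists j.
  have rT : r != setT by apply/eqP=> rT; rewrite rT inE in jr.
  (* Minimality of the counted extension is used here: [r] lies strictly between [s] and [t]. *)
  have fr : ~~ forced r y by move: (lv r); rewrite sr rt.
  have br : branches r (t, j) by rewrite /branches /= rt inE jr jt.
  have cr : h - #|r| = (h - #|s|).-1 by rewrite cardsU1 is_ add1n subnS.
  apply: leqW; rewrite -cr; apply: leq_trans (values_le rT fr br).
  apply: subset_leq_card; apply/subsetP=> u; rewrite !inE.
  case/existsP=> z /and5P[/= xz zj /andP[tz /forallP lz] _ /eqP zi].
  apply/existsP; exists z; rewrite zj /=; apply/and3P; split=> //.
    apply/forallP=> l; apply/implyP; rewrite !inE => /orP[/eqP->|ls]; first by rewrite yi zi.
    by move/forallP/(_ l): xy; move/forallP/(_ l): xz; rewrite ls /= => /eqP<- /eqP->.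
  apply/forallP=> r'; apply/implyP=> /andP[rr' r't].
  by move: (lz r'); rewrite r't (proper_trans sr rr').
have sub : values s x (t, j) \subset \bigcup_(q | q.2 \in S) F q.
  apply/subsetP=> v; rewrite inE => /existsP[y /and3P[xy yv lv]].
  have /andP[ty _] := lv.
  (* The witness is hit somewhere on [t] by induction, and not on [s], where it agrees with the
     missed [x]. *)
  have /existsP[i /andP[it yi]] : [exists i in t, y i \in S].
    by apply: IH ty; rewrite -ltnS; apply: leq_trans (proper_setT_gt st) _.
  apply/bigcupP; exists (i, y i) => //; rewrite inE; apply/existsP; exists y.
  apply/and5P; split=> //; rewrite inE it andbT /=.
  apply: contra miss => is_; apply/existsP; exists i; rewrite is_ /=.
  by move/forallP/(_ i): xy; rewrite is_ => /eqP->.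
rewrite -leqNgt; apply: leq_trans (subset_leq_card sub) _.
apply: leq_trans (card_bigcup_le (b := (threshold (h - #|s|).-1).+1) _) _ => //.
rewrite -[in leqRHS](prednK sn) /= leq_mul2r; apply/orP; right.
have -> : #|[pred q : 'I_h * T | q.2 \in S]| = #|setX [set: 'I_h] S|.
  by apply: eq_card => q; rewrite !inE.
by rewrite cardsX cardsT card_ord leq_mul2l S_small orbT.
Qed.

Definition kernel : {set T} :=
  [set v | [exists t : {set 'I_h}, [exists j in t,
    [exists y : {ffun 'I_h -> T}, (y j == v) && live set0 t y]]]].

(** The empty partial tuple has no coordinate to be hit, so [forced_hit] shows that it is not
    forced. Hence each of its at most [2 ^ h * h] branches contributes at most [threshold h]
    values. *)
Lemma kernel_small : #|kernel| <= 2 ^ h * h * threshold h.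
Proof.
(* A kernel element supplies the tuple [x] and a coordinate [j0], without which neither [forced] nor
   [set0 != setT] is available. *)
have [->|[v0]] := set_0Vmem kernel; first by rewrite cards0.
rewrite inE => /existsP[t0 /existsP[j0 /andP[jt0 /existsP[x _]]]].
have nT : set0 != [set: 'I_h] by apply/eqP=> /setP/(_ j0); rewrite !inE.
have nf : ~~ forced set0 x.
  by apply/negP=> /forced_hit/existsP[i]; rewrite inE.
have sub : kernel \subset \bigcup_(p | branches set0 p) values set0 x p.
  apply/subsetP=> v; rewrite inE => /existsP[t /existsP[j /andP[jt /existsP[y yv]]]].
  have bp : branches set0 (t, j).
    apply/andP; split; last by rewrite !inE.
    by rewrite proper0; apply/set0Pn; exists j.
  apply/bigcupP; exists (t, j) => //; rewrite inE; apply/existsP; exists y.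
  by rewrite yv andbT; apply/forallP=> i; rewrite inE.
apply: leq_trans (subset_leq_card sub) _.
apply: leq_trans (card_bigcup_le (b := threshold h) _) _.
  by move=> p bp; have := values_le nT nf bp; rewrite cards0 subn0.
rewrite leq_mul2r; apply/orP; right.
apply: leq_trans (max_card _) _; rewrite card_prod card_ord.
by rewrite -cardsT -powersetT card_powerset cardsT card_ord.
Qed.

(** Take an inclusion-minimal nonempty set of coordinates on which [x] is forced; the full set shows
    that one exists. [S] hits [x] there, and by minimality the element that it hits is in the
    kernel. *)
Lemma kernel_hits x : E x -> [exists i, x i \in S :&: kernel].
Proof.
move=> Ex; have /existsP[i0 _] := S_hits Ex.
pose P t := (t != set0) && forced t x.
have PT : P setT by rewrite /P forcedT Ex andbT; apply/set0Pn; exists i0.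
have [t /minsetP[/andP[t0 ft] tmin] _] := minset_exists PT.
have /existsP[i /andP[it xi]] := forced_hit ft.
apply/existsP; exists i; rewrite inE xi inE.
apply/existsP; exists t; apply/existsP; exists i; rewrite it.
apply/existsP; exists x; rewrite eqxx /=; apply/andP; split=> //.
apply/forallP=> r; apply/implyP=> /andP[r0 rt]; apply/negP=> fr.
have := tmin r; rewrite /P -proper0 r0 fr => /(_ isT (proper_sub rt)) e.
by rewrite e properxx in rt.
Qed.
End Kernel.

(** * Expressions for the kernel and for the reduced instances *)

(** Every nonzero value counts as true, so sums act as disjunctions and products as conjunctions.
    Truncated subtraction supplies negation, and [ebool] normalises to 0 or 1. *)
Definition enot (e : expr) := EOp Defs.Sub (ECst 1) e.
Definition ebool (e : expr) := enot (enot e).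
Definition elt (a b : expr) := ebool (EOp Defs.Sub b a).
Definition ele (a b : expr) := enot (EOp Defs.Sub a b).
Definition eeq (a b : expr) := EOp Mul (ele a b) (ele b a).
Definition eor (l : seq expr) := foldr (EOp Add) (ECst 0) l.
Definition eand (l : seq expr) := foldr (EOp Mul) (ECst 1) l.
Definition eif (c a b : expr) := EOp Add (EOp Mul (ebool c) a) (EOp Mul (enot c) b).

Lemma eval_esum w s x a b :
  eval w s (ESum x a b) = \sum_(i < eval w s a) eval w (upd s x i) b.
Proof. by []. Qed.

Lemma eval_evar w s i : eval w s (EVar i) = s i.
Proof. by []. Qed.

Section Connectives.
Variables (w : seq bool) (s : store).
Local Notation ev := (eval w s).

Lemma eval_enot e : ev (enot e) = (ev e == 0).
Proof. by rewrite /=; case: (ev e). Qed.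

Lemma eval_ebool e : ev (ebool e) = (ev e != 0).
Proof. by rewrite eval_enot eval_enot; case: (ev e). Qed.

Lemma eval_elt a b : ev (elt a b) = (ev a < ev b).
Proof. by rewrite eval_ebool /= subn_eq0 -ltnNge. Qed.

Lemma eval_ele a b : ev (ele a b) = (ev a <= ev b).
Proof. by rewrite eval_enot /= subn_eq0. Qed.

Lemma eval_eeq a b : ev (eeq a b) = (ev a == ev b).
Proof.
rewrite [LHS](_ : _ = ev (ele a b) * ev (ele b a)) // !eval_ele mulnb.
by rewrite eqn_leq.
Qed.

Lemma eval_eor l : (ev (eor l) != 0) = has (fun e => ev e != 0) l.
Proof. by elim: l => //= e l <-; rewrite addn_eq0 negb_and. Qed.

Lemma eval_eand l : (ev (eand l) != 0) = all (fun e => ev e != 0) l.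
Proof. by elim: l => //= e l <-; rewrite muln_eq0 negb_or. Qed.

Lemma eval_emul a b : (ev (EOp Mul a b) != 0) = (ev a != 0) && (ev b != 0).
Proof. by rewrite /= muln_eq0 negb_or. Qed.

Lemma eval_eif c a b : ev (eif c a b) = if ev c != 0 then ev a else ev b.
Proof.
rewrite [LHS](_ : _ = ev (ebool c) * ev a + ev (enot c) * ev b) //.
rewrite eval_ebool eval_enot.
by case: (ev c == 0) => /=; rewrite ?mul0n ?mul1n ?addn0.
Qed.
End Connectives.

Lemma sum_neq0 n (F : 'I_n -> nat) : (\sum_i F i != 0) = [exists i, F i != 0].
Proof. by rewrite sum_nat_eq0 negb_forall; apply: eq_existsb. Qed.

Lemma sum_card n (P : pred 'I_n) : \sum_i (P i : nat) = #|P|.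
Proof.
rewrite -sum1_card [RHS]big_mkcond; apply: eq_bigr => i _.
by rewrite unfold_in; case: (P i).
Qed.

(** Register layout: 0 is the answer, then the parameter, the number of vertices, the mask and an
    address. Registers 5 to 7 are loop variables over vertices, and those from 8 on hold the
    coordinates of a tuple. *)
Local Notation rk := 1.
Local Notation rn := 2.
Local Notation rm := 3.
Local Notation ra := 4.
Definition rX (i : nat) := 8 + i.

(** The offset skips the two unary blocks and their terminators. *)
Definition eadj (u v : expr) : expr :=
  ERead (EOp Add (EOp Add (EOp Add (EOp Add (EVar rk) (EVar rn)) (ECst 2))
                          (EOp Mul u (EVar rn))) v).

Section Pattern.
Variable H : sgraph.
Local Notation h := #|H|.

(** The hyperedges of the hitting set instance. Vertices of both graphs are replaced by their ranks,
    because registers hold numbers. *)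
Definition pattern_edge (G : sgraph) (x : {ffun 'I_h -> 'I_#|G|}) : bool :=
  [forall i, forall j, ((x i == x j) == (i == j)) &&
    (adj (enum_val (x i)) (enum_val (x j)) == adj (enum_val i : H) (enum_val j))].

Definition eedge : expr :=
  eand [seq EOp Mul (eeq (eeq (EVar (rX p.1)) (EVar (rX p.2))) (ECst (p.1 == p.2)))
                    (eeq (eadj (EVar (rX p.1)) (EVar (rX p.2)))
                         (ECst (adj (enum_val p.1 : H) (enum_val p.2))))
       | p : 'I_h * 'I_h <- enum {: 'I_h * 'I_h}].

Fixpoint ethreshold (m : nat) : expr :=
  if m is m'.+1 then
    EOp Mul (EOp Mul (ECst h) (EVar rk)) (EOp Add (ethreshold m') (ECst 1))
  else ECst 0.

Definition eexists (l : seq 'I_h) (e : expr) : expr :=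
  foldr (fun (i : 'I_h) e => ESum (rX i) (EVar rn) e) e l.

Definition elive (eQ : {set 'I_h} -> expr) (s t : {set 'I_h}) : expr :=
  EOp Mul (eQ t)
    (eand [seq enot (eQ r) | r <- enum [pred r : {set 'I_h} | (s \proper r) && (r \proper t)]]).

(** [ebool] makes a value count once, however many tuples witness it. *)
Definition ecount (eQ : {set 'I_h} -> expr) (s : {set 'I_h}) (p : {set 'I_h} * 'I_h) : expr :=
  ESum (rX p.2) (EVar rn)
    (ebool (eexists (enum [pred i | i \notin p.2 |: s]) (elive eQ s p.1))).

Fixpoint eforced (m : nat) (s : {set 'I_h}) : expr :=
  if s == setT then eedge else
  if m is m'.+1 then
    eor [seq elt (ethreshold (h - #|s|)) (ecount (eforced m') s p)
        | p : {set 'I_h} * 'I_h <- enum (branches s)]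
  else ECst 0.

Definition ekernel1 (v : nat) : expr :=
  eor [seq eexists (enum 'I_h)
             (EOp Mul (eeq (EVar (rX p.2)) (EVar v)) (elive (eforced h) set0 p.1))
      | p : {set 'I_h} * 'I_h <- enum [pred p : {set 'I_h} * 'I_h | p.2 \in p.1]].

Section Eval.
Variables (G : sgraph) (k : nat) (w : seq bool) (s0 : store).
Hypothesis s0k : s0 rk = k.
Hypothesis s0n : s0 rn = #|G|.
Hypothesis w_adj : forall u v : 'I_#|G|,
  read_input w (k + #|G| + 2 + u * #|G| + v) = adj (enum_val u : G) (enum_val v).
Local Notation n := #|G|.
Local Notation E := (@pattern_edge G).

Definition keeps (s : store) := forall i, i < 8 -> s i = s0 i.

Definition codes (t : {set 'I_h}) (s : store) (x : {ffun 'I_h -> 'I_n}) :=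
  forall i, i \in t -> s (rX i) = x i.

Definition update (x : {ffun 'I_h -> 'I_n}) i v : {ffun 'I_h -> 'I_n} :=
  [ffun j => if j == i then v else x j].

Lemma keeps_upd s i v : keeps s -> keeps (upd s (rX i) v).
Proof. by move=> ks j j8; rewrite upd_other ?ks // /rX; lia. Qed.

Lemma codes_upd (t : {set 'I_h}) s x i (v : 'I_n) :
  codes t s x -> codes (i |: t) (upd s (rX i) v) (update x i v).
Proof.
move=> c j; rewrite !inE updE ffunE /rX eqn_add2l.
by rewrite (inj_eq val_inj); case: eqP => //= _ jt; apply: c.
Qed.

Lemma codes_sub (t t' : {set 'I_h}) s x : t' \subset t -> codes t s x -> codes t' s x.
Proof. by move=> /subsetP sub c i /sub; apply: c. Qed.

Lemma eval_eadj s (a b : expr) (u v : 'I_n) : keeps s ->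
  eval w s a = u -> eval w s b = v ->
  eval w s (eadj a b) = adj (enum_val u : G) (enum_val v).
Proof. by move=> ks /= -> ->; rewrite !ks // s0k s0n w_adj. Qed.

Lemma eval_eedge s x : keeps s -> codes setT s x ->
  (eval w s eedge != 0) = E x.
Proof.
move=> ks cs; rewrite eval_eand all_map /E.
have pt (i j : 'I_h) :
    (eval w s (EOp Mul (eeq (eeq (EVar (rX i)) (EVar (rX j))) (ECst (i == j)))
       (eeq (eadj (EVar (rX i)) (EVar (rX j)))
            (ECst (adj (enum_val i : H) (enum_val j))))) != 0) =
    ((x i == x j) == (i == j)) &&
    (adj (enum_val (x i)) (enum_val (x j)) == adj (enum_val i : H) (enum_val j)).
  rewrite eval_emul !eval_eeq (@eval_eadj _ _ _ (x i) (x j)) /= ?cs ?inE //.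
  have nb (a b : bool) : (nat_of_bool a == b :> nat) = (a == b) by case: a; case: b.
  by rewrite !nb !eqb0 !negbK.
apply/allP/forallP => [al i|al [i j] _].
  by apply/forallP=> j; rewrite -pt; apply: (al (i, j)); rewrite mem_enum.
by move/forallP/(_ j): (al i); rewrite -pt.
Qed.

Lemma eval_ethreshold s m : keeps s -> eval w s (ethreshold m) = threshold h k m.
Proof. by move=> ks; elim: m => //= m ->; rewrite ks // s0k addn1. Qed.

(** The values of [x] on the coordinates in [l] are placeholders: the nested sums overwrite those
    registers. *)
Lemma eval_eexists (P : pred {ffun 'I_h -> 'I_n}) e :
  (forall s y, keeps s -> codes setT s y -> (eval w s e != 0) = P y) ->
  forall l (t : {set 'I_h}) s x, keeps s -> codes t s x ->
    (forall i, (i \in t) || (i \in l)) ->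
  (eval w s (eexists l e) != 0) = 
    [exists y : {ffun 'I_h -> 'I_n}, [forall i, (i \notin l) ==> (x i == y i)] && P y].
Proof.
move=> eP; elim=> [|i l IH] t s x ks cs tl.
  have cT : codes setT s x by move=> i _; apply: cs; have := tl i; rewrite in_nil orbF.
  rewrite /= (eP _ x) //; apply/idP/existsP => [Px|[y /andP[/forallP xy Py]]].
    by exists x; rewrite Px andbT; apply/forallP=> i; rewrite eqxx ?implybT.
  by suff -> : x = y by []; apply/ffunP=> i; move: (xy i); rewrite ?in_nil => /eqP.
rewrite [eexists _ _]/= /= ks // s0n sum_neq0.
have step (v : 'I_n) : (eval w (upd s (rX i) v) (eexists l e) != 0) =
    [exists y : {ffun 'I_h -> 'I_n}, [forall j, (j \notin l) ==> (update x i v j == y j)] && P y].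
  apply: IH (keeps_upd _ _ ks) (codes_upd (i := i) _ cs) _ => j.
  by have := tl j; rewrite !inE => /or3P[->|->|->]; rewrite ?orbT.
apply/existsP/existsP => [[v]|[y /andP[/forallP xy Py]]].
  rewrite step => /existsP[y /andP[/forallP xy Py]]; exists y; rewrite Py andbT.
  apply/forallP=> j; apply/implyP; rewrite inE negb_or => /andP[ji jl].
  by move: (xy j); rewrite jl ffunE (negPf ji).
exists (y i); rewrite step; apply/existsP; exists y; rewrite Py andbT.
apply/forallP=> j; apply/implyP=> jl; rewrite ffunE; case: (j =P i) => [-> //|/eqP ji].
by move: (xy j); rewrite inE negb_or ji jl.
Qed.

Lemma eval_eexists_all (P : pred {ffun 'I_h -> 'I_n}) e s :
  (forall s y, keeps s -> codes setT s y -> (eval w s e != 0) = P y) -> keeps s ->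
  (eval w s (eexists (enum 'I_h) e) != 0) = [exists y, P y].
Proof.
move=> eP ks; case: (pickP (fun _ : {ffun 'I_h -> 'I_n} => true)) => [x _|no].
  rewrite (eval_eexists eP (t := set0) (x := x)) //.
  - apply: eq_existsb => y; rewrite -[RHS]andTb; congr (_ && _).
    by apply/forallP=> i; rewrite mem_enum.
  - by move=> i; rewrite inE.
  - by move=> i; rewrite mem_enum orbT.
(* Without tuples the graph is empty and the pattern is not, so the outermost
   sum is empty. *)
have -> : [exists y, P y] = false by apply/existsP=> [[y]]; have := no y.
case E1: (enum 'I_h) => [|i l].
  have f (i : 'I_h) : 'I_n by have := mem_enum 'I_h i; rewrite E1.
  by have := no (finfun f).
rewrite eval_esum eval_evar ks // s0n.
case E2: n => [|n']; first by rewrite big_ord0.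
have pos : 0 < n by rewrite E2.
by have := no [ffun => Ordinal pos].
Qed.

Section Step.
Variables (Q : {set 'I_h} -> pred {ffun 'I_h -> 'I_n}) (eQ : {set 'I_h} -> expr).
Hypothesis eQE : forall t s x, keeps s -> codes t s x -> (eval w s (eQ t) != 0) = Q t x.

Lemma eval_elive t s s1 x : keeps s1 -> codes setT s1 x ->
  (eval w s1 (elive eQ s t) != 0) = live_for Q s t x.
Proof.
move=> ks cs; have cx r : codes r s1 x by apply: codes_sub cs; apply: subsetT.
rewrite eval_emul (eQE ks (cx t)) eval_eand all_map; congr (_ && _).
have nE r : (eval w s1 (enot (eQ r)) != 0) = ~~ Q r x.
  by rewrite eval_enot eqb0 -(eQE ks (cx r)).
apply/allP/forallP => [al r|al r].
  apply/implyP=> srt; have := al r; rewrite mem_enum inE srt => /(_ isT).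
  by rewrite -nE.
by rewrite mem_enum inE => srt; move: (al r); rewrite srt -nE.
Qed.

Lemma eval_ecount (s : {set 'I_h}) s1 x (p : {set 'I_h} * 'I_h) :
  p.2 \notin s -> keeps s1 -> codes s s1 x ->
  eval w s1 (ecount eQ s p) = #|values_for Q s x p|.
Proof.
case: p => t j; rewrite [(t, j).2]/= => js ks cs; rewrite /ecount eval_esum eval_evar ks // s0n.
rewrite -[RHS]sum1_card [RHS]big_mkcond; apply: eq_bigr => v _.
rewrite inE eval_ebool (eval_eexists (P := live_for Q s t) _ (t := j |: s) (x := update x j v)).
- set b1 := [exists y, _]; set b2 := [exists y, _]; suff -> : b2 = b1 by case: b1.
  apply: eq_existsb => y; rewrite [in RHS]andbA; congr (_ && _).
  apply/forallP/andP => [al|[/forallP xy /eqP yj] i].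
    split; last by move: (al j); rewrite mem_enum !inE eqxx ffunE eqxx eq_sym.
    apply/forallP=> i; apply/implyP=> is_; move: (al i).
    rewrite mem_enum !inE is_ orbT ffunE /=; case: (i =P j) => // ij.
    by rewrite -ij is_ in js.
  apply/implyP; rewrite mem_enum !inE negbK ffunE eq_sym => /orP[/eqP<-|is_].
    by rewrite eqxx yj.
  case: (j =P i) => [ij|_]; first by rewrite ij is_ in js.
  by move: (xy i); rewrite is_.
- by move=> s2 y; apply: eval_elive.
- exact: keeps_upd.
- exact: codes_upd.
- by move=> i; rewrite mem_enum !inE orbN.
Qed.
End Step.

Lemma eval_eforced m t s x : keeps s -> codes t s x ->
  (eval w s (eforced m t) != 0) = forced_rec k E m t x.
Proof.
elim: m t s x => [|m IH] t s x ks cs /=; case: (t =P setT) => [tT|_] //.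
- by apply: eval_eedge => //; rewrite -tT.
- by apply: eval_eedge => //; rewrite -tT.
have lE p : branches t p ->
    (eval w s (elt (ethreshold (h - #|t|)) (ecount (eforced m) t p)) != 0) =
    (threshold h k (h - #|t|) < #|values_for (forced_rec k E m) t x p|).
  case/andP=> _; rewrite inE => /andP[pt _].
  rewrite eval_elt eqb0 negbK eval_ethreshold //.
  by rewrite (eval_ecount (Q := forced_rec k E m) _ _ ks cs).
rewrite eval_eor has_map; apply/hasP/existsP => [[p]|[p /andP[bp lt]]].
  by rewrite mem_enum => bp lt; exists p; apply/andP; split=> //; rewrite -lE.
by exists p; [rewrite mem_enum | rewrite -lE in lt].
Qed.

Lemma eval_ekernel1 s v (u : 'I_n) : keeps s -> v < 8 -> s0 v = u ->
  (eval w s (ekernel1 v) != 0) = (u \in kernel k E).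
Proof.
move=> ks v8 vu; rewrite eval_eor has_map inE.
pose P (p : {set 'I_h} * 'I_h) (y : {ffun 'I_h -> 'I_n}) := (y p.2 == u) && live k E set0 p.1 y.
have ev (p : {set 'I_h} * 'I_h) : (eval w s (eexists (enum 'I_h)
    (EOp Mul (eeq (EVar (rX p.2)) (EVar v)) (elive (eforced h) set0 p.1))) != 0) =
    [exists y, P p y].
  rewrite (eval_eexists (P := P p) _ (t := set0) (x := [ffun => u])) //.
  - apply: eq_existsb => y; rewrite -[RHS]andTb; congr (_ && _).
    by apply/forallP=> i; rewrite mem_enum.
  - move=> s1 y ks1 cs1; rewrite eval_emul eval_eeq /= eqb0 negbK cs1 ?inE //.
    rewrite ks1 // vu (inj_eq val_inj); congr (_ && _).
    by apply: eval_elive => // t s2 x; apply: eval_eforced.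
  - by move=> i; rewrite inE.
  - by move=> i; rewrite mem_enum orbT.
apply/hasP/existsP => [[p]|[t /existsP[j /andP[jt ex]]]].
  rewrite mem_enum => pt ex; have {}ex : [exists y, P p y] by rewrite -ev.
  by exists p.1; apply/existsP; exists p.2; apply/andP; split.
exists (t, j); first by rewrite mem_enum.
by have : [exists y, P (t, j) y] by []; rewrite -ev.
Qed.
End Eval.
End Pattern.

(** * Subsets of an initial segment *)

Section Rank.
Variable n : nat.
Implicit Types (A : {set 'I_n}) (u v : 'I_n).

Definition nat_mem A (i : nat) : bool := if insub i is Some u then u \in A else false.

Lemma nat_memE A u : nat_mem A u = (u \in A).
Proof. by rewrite /nat_mem valK. Qed.

(** The position of an element of [A] in increasing order. It plays two parts: the index of the mask
    bit of a kernel vertex, and the new number of a vertex of G - S. *)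
Definition rank A (j : nat) : nat := \sum_(i < j) nat_mem A i.

Lemma rankS A j : rank A j.+1 = rank A j + nat_mem A j.
Proof. by rewrite /rank big_ord_recr. Qed.

Lemma rank_mono A i j : i <= j -> rank A i <= rank A j.
Proof.
move=> ij; rewrite -(subnKC ij); elim: (j - i) => [|d IH]; first by rewrite addn0.
by rewrite addnS rankS; apply: leq_trans IH (leq_addr _ _).
Qed.

Lemma rank_lt A u j : u \in A -> u < j -> rank A u < rank A j.
Proof.
by move=> uA uj; apply: leq_trans (rank_mono A uj); rewrite rankS nat_memE uA addn1.
Qed.

Lemma rank_full A : rank A n = #|A|.
Proof. by rewrite -sum_card; apply: eq_bigr => i _; rewrite nat_memE. Qed.

Lemma rank_inj A : {in A &, injective (fun u => rank A u)}.
Proof.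
move=> u v uA vA e; apply/val_inj; case: (ltngtP u v) => // lt.
  by have := rank_lt uA lt; rewrite e ltnn.
by have := rank_lt vA lt; rewrite e ltnn.
Qed.

Lemma index_filter (T : eqType) (p : pred T) (l : seq T) x :
  p x -> x \in l -> index x (filter p l) = count p (take (index x l) l).
Proof.
move=> px; elim: l => //= y l IH; rewrite inE.
have [->|xy] := eqVneq y x; first by rewrite px /= eqxx.
move=> /= xl.
by case: (p y); rewrite /= ?(negPf xy) IH.
Qed.

(** Sets of ordinals are enumerated increasingly, so the renumbering by [enum_val] can be computed
    by counting. *)
Lemma rank_enum_val A (i : 'I_#|A|) : rank A (enum_val i) = i.
Proof.
have vA := enum_valP i; set v := enum_val i in vA *.
have <- : index v (enum A) = i by rewrite /v /enum_val index_uniq // -?cardE ?enum_uniq.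
rewrite {1}/enum_mem -enumT index_filter ?mem_enum // index_enum_ord.
rewrite /rank -(big_mkord xpredT (fun i => nat_of_bool (nat_mem A i))) /index_iota subn0.
have -> : iota 0 v = [seq val u | u <- take v (enum 'I_n)].
  by rewrite map_take val_enum_ord take_iota (minn_idPl (ltnW (ltn_ord v))).
rewrite big_map -sum1_count [RHS]big_mkcond;
  apply: eq_bigr => u _; rewrite nat_memE.
by change (nat_of_bool (u \in A) = (if u \in A then 1 else 0)); case: (u \in A).
Qed.

Lemma bits_exist (b : nat -> bool) t : exists2 m, m < 2 ^ t &
  forall i, i < t -> odd (m %/ 2 ^ i) = b i.
Proof.
elim: t b => [|t IH] b; first by exists 0.
have [m mt bm] := IH (fun i => b i.+1); exists (m * 2 + b 0).
  by rewrite expnS; case: (b 0) => /=; lia.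
case=> [_|i it]; first by rewrite divn1 oddD oddM andbF; case: (b 0).
rewrite expnS divnMA divnMDl // (_ : b 0 %/ 2 = 0) ?addn0 ?bm //.
by case: (b 0).
Qed.

Definition masked A (m : nat) : {set 'I_n} :=
  [set v in A | odd (m %/ 2 ^ rank A v)].

(** Any upper bound [t] on the size will do: the search knows a bound on the kernel size in terms of
    [k], not the size itself. *)
Lemma masked_surj A (B : {set 'I_n}) t : B \subset A -> #|A| <= t ->
  exists2 m, m < 2 ^ t & masked A m = B.
Proof.
move=> BA At; have [m mt bm] := bits_exist (fun i => [exists v in B, rank A v == i]) t.
exists m => //; apply/setP=> v; rewrite inE.
case: (boolP (v \in A)) => [vA|vA] /=; last by apply/esym/negP=> /(subsetP BA); apply/negP.
rewrite bm; last first.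
  by apply: leq_trans At; rewrite -rank_full; apply: rank_lt.
apply/existsP/idP => [[u /andP[uB /eqP e]]|vB]; last by exists v; rewrite vB eqxx.
by rewrite -(rank_inj (subsetP BA _ uB) vA e).
Qed.
End Rank.

(** * Embeddings and isomorphisms *)

Definition embedding (K G : sgraph) (e : K -> G) :=
  injective e /\ {mono e : x y / adj x y}.

Lemma embedding_comp (K G L : sgraph) (e : K -> G) (f : G -> L) :
  embedding e -> embedding f -> embedding (f \o e).
Proof.
move=> [ei em] [fi fm]; split; first exact: inj_comp.
by move=> x y /=; rewrite fm em.
Qed.

Lemma embedding_induced (G : sgraph) (A : {set G}) :
  embedding (val : induced A -> G).
Proof. by split=> //; apply: val_inj. Qed.

(** Vertex-deleted graphs live on different types; comparing their images in a common host graph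
    avoids explicit bijections between those types. *)
Lemma iso_of_embeddings (K L G : sgraph) (e : K -> G) (f : L -> G) :
    embedding e -> embedding f ->
    (forall g, (exists x, e x = g) <-> (exists y, f y = g)) ->
  iso K L.
Proof.
move=> [ei em] [fi fm] im.
have exf x : exists y, f y == e x.
  by have [y fy] := (im (e x)).1 (ex_intro _ x erefl); exists y; apply/eqP.
have exe y : exists x, e x == f y.
  by have [x ex] := (im (f y)).2 (ex_intro _ y erefl); exists x; apply/eqP.
pose p x := xchoose (exf x); pose q y := xchoose (exe y).
have fp x : f (p x) = e x := eqP (xchooseP (exf x)).
have eq_ y : e (q y) = f y := eqP (xchooseP (exe y)).
exists p; last by move=> x y; rewrite -fm !fp em.
by exists q => [x|y]; [apply: ei; rewrite eq_ fp | apply: fi; rewrite fp eq_].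
Qed.

Lemma iso_induced_embedding (K H : sgraph) :
  (exists A : {set K}, iso (induced A) H) <-> exists e : H -> K, embedding e.
Proof.
split=> [[A [f [g fK gK] fm]]|[e [ei em]]].
  exists (fun y => val (g y)); split; first by apply: inj_comp val_inj (can_inj gK).
  by move=> x y; rewrite -[adj (val _) _]fm !gK.
exists [set e y | y : H]; apply: (iso_of_embeddings (embedding_induced _)).
  by split; [exact: ei | exact: em].
move=> g; split=> [[[x /= xP] <-]|[y <-]] /=.
  by have /imsetP[y _ ->] := xP; exists y.
have yP : e y \in [set e y | y : H] by apply: imset_f.
by exists (exist _ (e y) yP).
Qed.

Section Reduced.
Variables (G : sgraph) (S : {set 'I_#|G|}).
Local Notation n := #|G|.

Definition reduced_vertex (i : 'I_#|~: S|) : G := enum_val (enum_val i).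

Definition reduced_adj : rel 'I_#|~: S| :=
  fun i j => adj (reduced_vertex i) (reduced_vertex j).

Lemma reduced_sym : symmetric reduced_adj.
Proof. by move=> i j; apply: adj_sym. Qed.

Lemma reduced_irr : irreflexive reduced_adj.
Proof. by move=> i; apply: adj_irr. Qed.

(* G - S renumbered by an initial segment, so that its encoding can be computed
   from S. *)
Definition reduced : sgraph := SGraph reduced_sym reduced_irr.

Lemma embedding_reduced : embedding (reduced_vertex : reduced -> G).
Proof. by split=> // i j /enum_val_inj/enum_val_inj. Qed.

Lemma reduced_vertexP (g : G) :
  (exists i : reduced, reduced_vertex i = g) <-> enum_rank g \notin S.
Proof.
split=> [[i <-]|gS].
  by rewrite /reduced_vertex enum_valK; have := enum_valP i; rewrite inE.
have gS' : enum_rank g \in ~: S by rewrite inE.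
exists (enum_rank_in gS' (enum_rank g)).
by rewrite /reduced_vertex enum_rankK_in // enum_rankK.
Qed.

Definition avoids_pattern (H : sgraph) : bool :=
  ~~ [exists x : {ffun 'I_#|H| -> 'I_n}, pattern_edge x && [forall i, x i \notin S]].

(** [K] is any graph embedded onto the complement of [S], so that the lemma covers both [del] and
    [reduced]. *)
Lemma avoids_patternP (K H : sgraph) (e : K -> G) : embedding e ->
    (forall g, (exists z, e z = g) <-> enum_rank g \notin S) ->
  ~~ avoids_pattern H <-> exists f : H -> K, embedding f.
Proof.
move=> ee im; rewrite negbK; split=> [/existsP[x /andP[xE /forallP xS]]|[f ef]].
  have ex y : exists z, e z == enum_val (x (enum_rank y)).
    have [|z ez] := (im (enum_val (x (enum_rank y)))).2; first by rewrite enum_valK.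
    by exists z; apply/eqP.
  pose f y := xchoose (ex y).
  have ef y : e (f y) = enum_val (x (enum_rank y)) := eqP (xchooseP (ex y)).
  have xP y y' : ((x (enum_rank y) == x (enum_rank y')) = (y == y')) *
      (adj (enum_val (x (enum_rank y))) (enum_val (x (enum_rank y'))) = adj y y').
    move/forallP/(_ (enum_rank y))/forallP/(_ (enum_rank y')): xE.
    by rewrite !enum_rankK (inj_eq enum_rank_inj) => /andP[/eqP-> /eqP->].
  case: ee => ei em; exists f; split=> [y y' ff|y y'].
    by apply/eqP; rewrite -xP -(inj_eq enum_val_inj) -!ef ff.
  by rewrite -em !ef xP.
have [ci cm] := embedding_comp ef ee.
pose x := [ffun i => enum_rank (e (f (enum_val i)))] : {ffun 'I_#|H| -> 'I_n}.
apply/existsP; exists x; apply/andP; split; last first.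
  by apply/forallP=> i; rewrite ffunE; apply/im; exists (f (enum_val i)).
apply/forallP=> i; apply/forallP=> j; rewrite !ffunE !enum_rankK.
rewrite (inj_eq enum_rank_inj) (inj_eq ci) (inj_eq enum_val_inj) eqxx /=.
by rewrite -[in X in _ == X]cm.
Qed.

Lemma avoids_all_class (Psi : graph_class) (Phi : seq sgraph) (K : sgraph) (e : K -> G) :
    characterized_by Psi Phi -> embedding e ->
    (forall g, (exists z, e z = g) <-> enum_rank g \notin S) ->
  all avoids_pattern Phi <-> Psi K.
Proof.
move=> PsiP ee im; rewrite PsiP.
(* Links the boolean test with [List.In], which appears in [characterized_by] because [sgraph]
   carries no decidable equality. *)
have allN : ~~ all avoids_pattern Phi <->
    exists H, List.In H Phi /\ ~~ avoids_pattern H.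
  rewrite -has_predC; elim: Phi {PsiP} => [|H l IH] /=; first by split=> // [[H []]].
  split=> [/orP[av|/IH[H' [inl av]]]|[H' [[<-|inl] av]]].
  - by exists H; split=> //; left.
  - by exists H'; split=> //; right.
  - by rewrite av.
  - by apply/orP; right; apply/IH; exists H'.
split=> [al [A [H [inP isoA]]]|no].
  have : ~~ all avoids_pattern Phi.
    apply/allN; exists H; split=> //; apply/(avoids_patternP _ ee im).
    by apply/iso_induced_embedding; exists A.
  by rewrite al.
(* The test is boolean, so the double negation can be removed constructively. *)
apply/negPn/negP=> /allN[H [inP /(avoids_patternP _ ee im)]].
by move=> /iso_induced_embedding[A isoA]; apply: no; exists A, H.
Qed.
End Reduced.

(** * Reading an encoded instance *)

Lemma read_input_cat w1 w2 a : read_input (w1 ++ w2) a =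
  if a < size w1 then read_input w1 a else read_input w2 (a - size w1).
Proof. by rewrite /read_input map_cat nth_cat size_map. Qed.

Lemma read_input_nseq k a : a < k -> read_input (nseq k true) a = 1.
Proof. by move=> ak; rewrite /read_input map_nseq nth_nseq ak. Qed.

Definition adj_bits (G : sgraph) : seq bool := [seq adj u v | u <- enum G, v <- enum G].

Lemma size_adj_bits G : size (adj_bits G) = #|G| * #|G|.
Proof. by rewrite size_allpairs -cardE. Qed.

Lemma size_enc_graph G k : size (enc_graph (G, k)) = k + #|G| + 2 + #|G| * #|G|.
Proof.
rewrite !size_cat /= size_cat /= -/(adj_bits G) size_adj_bits !size_nseq.
by move: (#|G| * #|G|) => c; lia.
Qed.

Lemma read_enc_graph G k a : read_input (enc_graph (G, k)) a =
  if a < k then 1 else if a == k then 0 else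
  if a < k + 1 + #|G| then 1 else if a == k + 1 + #|G| then 0 else
  read_input (adj_bits G) (a - (k + #|G| + 2)).
Proof.
rewrite /enc_graph read_input_cat size_nseq; case: ltnP => [/read_input_nseq-> //|ka].
case: eqP => [->|/eqP ne]; first by rewrite subnn.
have -> : a - k = (a - k.+1).+1 by lia.
rewrite -[read_input (_ :: _) _]/(read_input (nseq #|G| true ++ false :: adj_bits G) _).
rewrite read_input_cat size_nseq; have -> : (a - k.+1 < #|G|) = (a < k + 1 + #|G|) by lia.
case: ifP => lt; first by apply: read_input_nseq; lia.
case: eqP => [->|/eqP ne']; first by rewrite (_ : _ - _ - _ = 0) //; lia.
by have -> : a - k.+1 - #|G| = (a - (k + #|G| + 2)).+1 by lia.
Qed.

Lemma nth_allpairs (T U R : Type) (f : T -> U -> R) x0 y0 z0 s t i j :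
  i < size s -> j < size t ->
  nth z0 [seq f x y | x <- s, y <- t] (i * size t + j) = f (nth x0 s i) (nth y0 t j).
Proof.
elim: s i => //= x s IH [|i] lt jt; rewrite nth_cat size_map.
  by rewrite mul0n add0n jt (nth_map y0).
rewrite mulSn -addnA ltnNge leq_addr /= addKn; exact: IH.
Qed.

Lemma read_adj_bits (G : sgraph) (u v : G) :
  read_input (adj_bits G) (enum_rank u * #|G| + enum_rank v) = adj u v.
Proof.
have lt (x y : 'I_#|G|) : x * #|G| + y < #|G| * #|G|.
  by case: x y => [x /= xl] [y /= yl]; move: #|G| xl yl => c; nia.
rewrite /read_input (nth_map false) ?size_adj_bits ?lt //; congr nat_of_bool.
rewrite /adj_bits {2}cardE (@nth_allpairs _ _ _ _ u u) -?cardE //.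
by rewrite !nth_enum_rank.
Qed.

Lemma read_enc_adj (G : sgraph) k (u v : 'I_#|G|) :
  read_input (enc_graph (G, k)) (k + #|G| + 2 + u * #|G| + v) = adj (enum_val u : G) (enum_val v).
Proof.
rewrite read_enc_graph; do 4 (case: ifP => [|_]; first by move: (_ * _) => c; lia).
rewrite -addnA addKn.
by rewrite -{1}(enum_valK u) -{1}(enum_valK v) read_adj_bits.
Qed.

(** * Candidate deletion sets *)

Definition kernel_bound (Phi : seq sgraph) (k : nat) : nat :=
  sumn [seq 2 ^ #|H| * #|H| * threshold #|H| k #|H| | H : sgraph <- Phi].

Definition ekernel_bound (Phi : seq sgraph) : expr :=
  foldr (fun (H : sgraph) e =>
    EOp Add (EOp Mul (ECst (2 ^ #|H| * #|H|)) (ethreshold H #|H|)) e) (ECst 0) Phi.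

Lemma eval_ekernel_bound w s Phi : eval w s (ekernel_bound Phi) = kernel_bound Phi (s rk).
Proof.
have thrE H m : eval w s (ethreshold H m) = threshold #|H| (s rk) m.
  by elim: m => //= m ->; rewrite addn1.
by elim: Phi => //= H Phi ->; rewrite thrE.
Qed.

Definition ekernel (Phi : seq sgraph) (v : nat) : expr :=
  eor [seq ekernel1 H v | H <- Phi].

(** The sum over register 5 is the rank of the vertex in the kernel, that is, the position of its
    bit in the mask. *)
Definition echosen Phi (v : nat) : expr :=
  EOp Mul (ebool (ekernel Phi v))
    (EOp Mod (EShr (EVar rm) (ESum 5 (EVar v) (ebool (ekernel Phi 5)))) (ECst 2)).

Definition esize Phi : expr := ESum 6 (EVar rn) (echosen Phi 6).

Definition eavoids Phi (H : sgraph) : expr :=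
  enot (eexists (enum 'I_#|H|) (EOp Mul (eedge H)
    (eand [seq enot (ESum 6 (EVar rn) (EOp Mul (eeq (EVar 6) (EVar (rX i))) (echosen Phi 6)))
          | i : 'I_#|H| <- enum 'I_#|H|]))).

Definition ecandidate Phi : expr :=
  ebool (EOp Mul (ele (esize Phi) (EVar rk)) (eand [seq eavoids Phi H | H <- Phi])).

(** A search written as a sum: the only vertex contributing is the one outside the chosen set whose
    rank among the remaining vertices is [e]. *)
Definition eselect Phi (e : expr) : expr :=
  ESum 7 (EVar rn) (EOp Mul (EVar 7)
    (EOp Mul (enot (echosen Phi 7)) (eeq e (ESum 6 (EVar 7) (enot (echosen Phi 6)))))).

(* The bit at address ra of the encoding of the reduced instance. *)
Definition eread Phi : expr :=
  let a := EVar ra in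
  let k' := EOp Defs.Sub (EVar rk) (esize Phi) in
  let n' := EOp Defs.Sub (EVar rn) (esize Phi) in
  let z := EOp Add (EOp Add k' (ECst 1)) n' in
  let b := EOp Defs.Sub a (EOp Add (EOp Add k' n') (ECst 2)) in
  eif (elt a k') (ECst 1) (eif (eeq a k') (ECst 0)
    (eif (elt a z) (ECst 1) (eif (eeq a z) (ECst 0)
      (eif (elt b (EOp Mul n' n'))
        (eadj (eselect Phi (EOp Div b n')) (eselect Phi (EOp Mod b n'))) (ECst 2))))).

Section Instance.
Variables (Phi : seq sgraph) (G : sgraph) (k : nat) (w : seq bool).
Local Notation n := #|G|.
Hypothesis w_adj : forall u v : 'I_n,
  read_input w (k + n + 2 + u * n + v) = adj (enum_val u : G) (enum_val v).

Definition full_kernel : {set 'I_n} :=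
  [set v | has (fun H => v \in kernel k (@pattern_edge H G)) Phi].

Definition chosen (m : nat) : {set 'I_n} := masked full_kernel m.

Lemma eval_ekernel s v (u : 'I_n) : s rk = k -> s rn = n -> v < 8 -> s v = u ->
  (eval w s (ekernel Phi v) != 0) = (u \in full_kernel).
Proof.
move=> sk sn v8 vu; rewrite eval_eor has_map inE; apply: eq_has => H /=.
by apply: (eval_ekernel1 H sk sn w_adj).
Qed.

Variable m : nat.
Local Notation S := (chosen m).

Definition base (s : store) := [/\ s rk = k, s rn = n & s rm = m].

Lemma base_upd s x v : 4 <= x -> base s -> base (upd s x v).
Proof. by move=> x4 [sk sn sm]; split; rewrite upd_other //; lia. Qed.

Lemma eval_echosen s v (u : 'I_n) : base s -> v < 8 -> s v = u ->
  eval w s (echosen Phi v) = (u \in S).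
Proof.
move=> bs v8 vu; have [sk sn sm] := bs.
rewrite [LHS](_ : _ = eval w s (ebool (ekernel Phi v)) *
  ((s rm %/ 2 ^ \sum_(i < s v) eval w (upd s 5 i) (ebool (ekernel Phi 5))) %% 2)) //.
rewrite eval_ebool (@eval_ekernel _ _ u) // sm vu.
have -> : \sum_(i < u) eval w (upd s 5 i) (ebool (ekernel Phi 5)) = rank full_kernel u.
  apply: eq_bigr => i _; pose i' := widen_ord (ltnW (ltn_ord u)) i.
  by rewrite eval_ebool (@eval_ekernel _ _ i') // -nat_memE.
by rewrite modn2 mulnb; congr nat_of_bool; rewrite [RHS]inE.
Qed.

Lemma eval_esize s : base s -> eval w s (esize Phi) = #|S|.
Proof.
move=> bs; have [_ sn _] := bs; rewrite eval_esum eval_evar sn -sum_card.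
by apply: eq_bigr => i _; rewrite (@eval_echosen _ _ i) //; apply: base_upd.
Qed.

Lemma eval_eavoids s H : base s -> (eval w s (eavoids Phi H) != 0) = avoids_pattern S H.
Proof.
move=> bs; have [sk sn sm] := bs; rewrite eval_enot eqb0 negbK.
rewrite /avoids_pattern -[LHS]negbK; congr (~~ _).
have kb s1 : keeps s s1 -> base s1 by move=> ks; split; rewrite ks.
have kk : keeps s s by [].
apply: (eval_eexists_all sk sn _ kk) => s1 y k1 c1.
rewrite eval_emul (eval_eedge sk sn w_adj k1 c1); congr (_ && _).
have pt (i : 'I_#|H|) : (eval w s1 (enot (ESum 6 (EVar rn)
    (EOp Mul (eeq (EVar 6) (EVar (rX i))) (echosen Phi 6)))) != 0) = (y i \notin S).
  rewrite eval_enot eqb0 negbK -[LHS]negbK; congr (~~ _).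
  rewrite eval_esum eval_evar k1 // sn sum_neq0.
  have vE (v : 'I_n) : (eval w (upd s1 6 v) (EOp Mul (eeq (EVar 6) (EVar (rX i)))
      (echosen Phi 6)) != 0) = (v == y i) && (v \in S).
    rewrite eval_emul eval_eeq (@eval_echosen _ _ v) //; last exact/base_upd/kb.
    by rewrite !eval_evar upd_same upd_other // c1 ?inE // !eqb0 !negbK.
  apply/existsP/idP => [[v]|yS]; first by rewrite vE => /andP[/eqP->].
  by exists (y i); rewrite vE eqxx.
rewrite eval_eand all_map; apply/allP/forallP => [al i|al i _].
  by rewrite -pt; apply: al; rewrite mem_enum.
by have := al i; rewrite -pt.
Qed.

Lemma eval_ecandidate s : base s ->
  eval w s (ecandidate Phi) = (#|S| <= k) && all (avoids_pattern S) Phi.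
Proof.
move=> bs; have [sk sn sm] := bs.
rewrite eval_ebool eval_emul eval_ele eval_esize // eval_evar sk eqb0 negbK.
congr (nat_of_bool (_ && _)); rewrite eval_eand all_map; apply: eq_all => H /=.
exact: eval_eavoids.
Qed.

(** The hypothesis on [e] ranges over stores because the sum evaluates [e] with its own loop
    variable changed. *)
Lemma eval_eselect s e (i : 'I_#|~: S|) : base s ->
  (forall s', base s' -> s' ra = s ra -> eval w s' e = i) ->
  eval w s (eselect Phi e) = enum_val i.
Proof.
move=> bs ei; have [sk sn sm] := bs; rewrite eval_esum eval_evar sn.
have vE (v : 'I_n) : eval w (upd s 7 v) (EOp Mul (EVar 7)
    (EOp Mul (enot (echosen Phi 7)) (eeq e (ESum 6 (EVar 7) (enot (echosen Phi 6)))))) =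
    v * ((v \notin S) && (i == rank (~: S) v :> nat)).
  have b7 : base (upd s 7 v) by apply: base_upd.
  rewrite [LHS](_ : _ = v * (eval w (upd s 7 v) (enot (echosen Phi 7)) *
    eval w (upd s 7 v) (eeq e (ESum 6 (EVar 7) (enot (echosen Phi 6)))))) //.
  rewrite eval_enot (@eval_echosen _ _ v) // eqb0 eval_eeq ei // mulnb.
  rewrite eval_esum; congr (v * (_ && (_ == _))); apply: eq_bigr => u _.
  pose u' := widen_ord (ltnW (ltn_ord v)) u.
  have b6 : base (upd (upd s 7 v) 6 u) by apply: base_upd.
  rewrite eval_enot (@eval_echosen _ _ u') //.
  by rewrite eqb0 -in_setC -nat_memE.
under eq_bigr => v _ do rewrite vE.
have := enum_valP i; rewrite in_setC => iS.
rewrite (bigD1 (enum_val i)) //= iS rank_enum_val eqxx muln1.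
rewrite big1 ?addn0 // => v ne; case: (boolP (v \notin S)) => [vS|]; last by rewrite muln0.
case: eqP => [e1|]; last by rewrite muln0.
case/eqP: ne; have vS' : v \in ~: S by rewrite in_setC.
by apply: (rank_inj vS' (enum_valP i)); rewrite -e1 rank_enum_val.
Qed.

Lemma card_reduced : #|reduced S| = n - #|S|.
Proof. by rewrite /= card_ord cardsCs setCK card_ord. Qed.

Lemma eval_eread s : base s ->
  eval w s (eread Phi) = read_input (enc_graph (reduced S, k - #|S|)) (s ra).
Proof.
move=> bs; have [sk sn sm] := bs.
pose ek := EOp Defs.Sub (EVar rk) (esize Phi).
pose en := EOp Defs.Sub (EVar rn) (esize Phi).
pose eb := EOp Defs.Sub (EVar ra) (EOp Add (EOp Add ek en) (ECst 2)).
have kE s1 : base s1 -> eval w s1 ek = k - #|S|.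
  by move=> b1; rewrite -(eval_esize b1); case: b1 => <-.
have nE s1 : base s1 -> eval w s1 en = n - #|S|.
  by move=> b1; rewrite -(eval_esize b1); case: b1 => _ <-.
rewrite read_enc_graph card_reduced /eread -/ek -/en -/eb.
have zE : eval w s (EOp Add (EOp Add ek (ECst 1)) en) = k - #|S| + 1 + (n - #|S|).
  by rewrite -(kE s bs) -(nE s bs).
have bE s1 : base s1 -> s1 ra = s ra ->
    eval w s1 eb = s ra - (k - #|S| + (n - #|S|) + 2).
  by move=> b1 <-; rewrite -(kE s1 b1) -(nE s1 b1).
have nnE : eval w s (EOp Mul en en) = (n - #|S|) * (n - #|S|) by rewrite -(nE s bs).
rewrite !eval_eif !eval_elt !eval_eeq zE kE // bE // nnE eval_evar !eqb0 !negbK.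
set n' := n - #|S|; set b := s ra - _.
have cardS : #|~: S| = n' by rewrite cardsCs setCK card_ord.
do 4 (case: ifP => // _); case: ltnP => [lt|ge]; last first.
  rewrite /read_input nth_default // size_map size_adj_bits card_reduced.
  exact: ge.
have n'0 : 0 < n' by rewrite lt0n; apply: contraTneq lt => ->; rewrite ltn0.
have ilt : b %/ n' < #|~: S| by rewrite cardS ltn_divLR.
have jlt : b %% n' < #|~: S| by rewrite cardS ltn_mod.
have eE op s1 : base s1 -> s1 ra = s ra ->
    eval w s1 (EOp op eb en) = eval_binop op b n'.
  by move=> b1 a1; rewrite /b /n' -(bE s1 b1 a1) -(nE s1 b1).
pose i := Ordinal ilt; pose j := Ordinal jlt.
rewrite (eval_eadj sk sn w_adj (s := s) (u := enum_val i) (v := enum_val j)) //.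
(* The vertices of the reduced graph are ordinals and equal their ranks, so row and column are
   quotient and remainder. *)
- have -> : b = enum_rank (i : reduced S) * #|reduced S| + enum_rank (j : reduced S).
    by rewrite !enum_rank_ord /= card_reduced -divn_eq.
  by rewrite read_adj_bits.
- by apply: eval_eselect => // s1 b1 a1; rewrite eE.
- by apply: eval_eselect => // s1 b1 a1; rewrite eE.
Qed.
End Instance.

(** * Correctness of the reduction to the restricted problem *)

Section Candidates.
Variables (G : sgraph) (k : nat).
Local Notation n := #|G|.
Implicit Types S K : {set 'I_n}.

Lemma avoids_pattern_hits S (H : sgraph) : avoids_pattern S H ->
  forall x : {ffun 'I_#|H| -> 'I_n}, pattern_edge x -> [exists i, x i \in S].
Proof.
move=> av x xE; apply: contraNT av => no; apply/existsP; exists x; rewrite xE /=.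
by apply/forallP=> i; apply: contraNN no => xi; apply/existsP; exists i.
Qed.

(** When no such [S] exists the kernel may exceed the bound, but then no mask passes the candidate
    test either, and a search limited to [2 ^ kernel_bound] masks stays correct. *)
Lemma full_kernel_small Phi S : #|S| <= k -> all (avoids_pattern S) Phi ->
  #|full_kernel Phi G k| <= kernel_bound Phi k.
Proof.
move=> Sk; elim: Phi => [_|H Phi IH /= /andP[av /IH le]].
  by rewrite leqn0 cards_eq0; apply/eqP/setP=> v; rewrite !inE.
have -> : full_kernel (H :: Phi) G k = kernel k (@pattern_edge H G) :|: full_kernel Phi G k.
  by apply/setP=> v; rewrite in_setU ![v \in full_kernel _ _ _]inE.
apply: leq_trans (leq_card_setU _ _) _; apply: leq_add le.
exact: kernel_small Sk (avoids_pattern_hits av).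
Qed.

Lemma avoids_pattern_kernel Phi S : #|S| <= k -> all (avoids_pattern S) Phi ->
  all (avoids_pattern (S :&: full_kernel Phi G k)) Phi.
Proof.
move=> Sk; set K := full_kernel _ _ _.
have KP v : has (fun H => v \in kernel k (@pattern_edge H G)) Phi -> v \in K.
  by rewrite inE.
(* The induction shortens the list of patterns to be avoided, while [K] remains the kernel of the
   full list. *)
elim: (Phi) KP => //= H l IH KP /andP[av al]; apply/andP; split; last first.
  by apply: IH al => v vl; apply: KP; rewrite vl orbT.
apply/existsP=> [[x /andP[xE /forallP no]]].
have /existsP[i] := kernel_hits Sk (avoids_pattern_hits av) xE.
rewrite in_setI => /andP[xS xK]; have := no i; rewrite in_setI xS /=.
by rewrite KP // xK.
Qed.
End Candidates.

Lemma embedding_del (G : sgraph) (S : {set G}) : embedding (val : del S -> G).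
Proof. exact: embedding_induced. Qed.

Lemma delP (G : sgraph) (S : {set G}) g :
  (exists x : del S, val x = g) <-> g \notin S.
Proof.
split=> [[x <-]|gS]; first by have := valP x; rewrite inE.
have gP : g \in ~: S by rewrite inE.
by exists (exist _ g gP).
Qed.

Section Reduction.
Variables (Pi Psi : graph_class) (Phi : seq sgraph).
Hypothesis Pi_sub_Psi : forall G : sgraph, Pi G -> Psi G.
Hypothesis Psi_char : characterized_by Psi Phi.
Variables (G : sgraph) (k : nat).
Local Notation n := #|G|.

Definition candidate (m : nat) : bool :=
  (#|chosen Phi G k m| <= k) && all (avoids_pattern (chosen Phi G k m)) Phi.

Lemma candidate_class m : candidate m -> Psi (reduced (chosen Phi G k m)).
Proof.
case/andP=> _ al.
exact/(avoids_all_class Psi_char (embedding_reduced _) (@reduced_vertexP _ _)).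
Qed.

Lemma del_iso_reduced (T : {set 'I_n}) (S0 : {set G}) (S' : {set reduced T}) :
  (forall g, g \notin S0 <->
     exists2 i : reduced T, i \notin S' & reduced_vertex i = g) ->
  iso (del S') (del S0).
Proof.
move=> H; apply: (iso_of_embeddings
  (embedding_comp (embedding_del S') (embedding_reduced T)) (embedding_del S0)) => g.
rewrite delP H; split=> [[x <-]|[i iS <-]].
  by exists (val x) => //; apply/delP; exists x.
by have [x xi] := (delP S' i).2 iS; exists x; rewrite /= xi.
Qed.

(** A solution splits into its part in the kernel, which alone already leads into Psi, and a rest
    that solves the reduced instance with the remaining budget. Conversely, a candidate and a
    solution of its reduced instance unite to a solution. *)
Lemma Del_yes_candidates : yes (p := Del Pi) (G, k) <->
  exists m, [/\ m < 2 ^ kernel_bound Phi k, candidate m &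
    yes (p := Del Pi) (reduced (chosen Phi G k m), k - #|chosen Phi G k m|)].
Proof.
split=> [[S0 /= [S0k PiS0]]|[m [_ /andP[Tk _] [S' /= [S'k PiS']]]]].
  pose S1 := [set v : 'I_n | enum_val v \in S0].
  have S1P g : (enum_rank g \in S1) = (g \in S0) by rewrite inE enum_rankK.
  have S1c : #|S1| = #|S0|.
    rewrite -[RHS](card_imset _ enum_rank_inj); apply: eq_card => v.
    apply/idP/imsetP => [|[g gS ->]]; last by rewrite S1P.
    by rewrite inE => vS; exists (enum_val v); rewrite ?enum_valK.
  have S1k : #|S1| <= k by rewrite S1c.
  have av1 : all (avoids_pattern S1) Phi.
    (* The inclusion of Pi in Psi enters here: the graph left by a solution lies in Psi, so the
       solution hits every copy of a forbidden graph. *)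
    apply/(avoids_all_class Psi_char (embedding_del S0)); last exact: Pi_sub_Psi.
    by move=> g; rewrite delP S1P.
  have sub : S1 :&: full_kernel Phi G k \subset full_kernel Phi G k by apply: subsetIr.
  have [m mlt mE] := masked_surj sub (full_kernel_small S1k av1).
  exists m; rewrite /candidate /chosen mE; set T := S1 :&: _.
  have TS1 : T \subset S1 by apply: subsetIl.
  have Tk : #|T| <= k by apply: leq_trans (subset_leq_card TS1) S1k.
  split=> //; first by rewrite Tk avoids_pattern_kernel.
  (* The rest of the solution, carried over to the renumbered graph. *)
  pose S' := [set i : reduced T | reduced_vertex i \in S0].
  exists S' => /=; split.
    rewrite -(card_imset _ (@enum_val_inj _ _)) /=.
    apply: (@leq_trans #|S1 :\: T|).
      apply: subset_leq_card; apply/subsetP=> v /imsetP[i].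
      rewrite inE => iS ->; rewrite in_setD.
      by have := enum_valP i; rewrite in_setC => -> /=; rewrite inE.
    by rewrite cardsD (setIidPr TS1) leq_sub2r.
  apply: in_class_iso PiS0; apply: iso_of_embeddings (embedding_del S0)
    (embedding_comp (embedding_del S') (embedding_reduced T)) _ => g.
  rewrite delP; split=> [gS|[x <-] /=]; last first.
    by have := valP x; rewrite !inE.
  have [|i iE] := (reduced_vertexP T g).2.
    by apply: contraNN gS => /(subsetP TS1); rewrite S1P.
  have [|x xi] := (delP S' i).2; first by rewrite inE iE.
  by exists x; rewrite /= xi.
move: (chosen Phi G k m) Tk S' S'k PiS' => T Tk S' S'k PiS'.
pose S0 := [set enum_val v | v in T] :|: [set reduced_vertex i | i in S'].
exists S0 => /=; split.
  apply: leq_trans (leq_card_setU _ _) _.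
  rewrite -(subnKC Tk); apply: leq_add; first exact: leq_imset_card.
  exact: leq_trans (leq_imset_card _ _) S'k.
apply: in_class_iso PiS'; apply: del_iso_reduced => g; split.
  rewrite in_setU negb_or => /andP[gT gS].
  have [|i iE] := (reduced_vertexP T g).2.
    by apply: contraNN gT => gT; apply/imsetP; exists (enum_rank g); rewrite ?enum_rankK.
  by exists i => //; apply: contraNN gS => iS; apply/imsetP; exists i.
case=> i iS <-; rewrite in_setU negb_or; apply/andP; split.
  apply/imsetP=> [[v vT]]; rewrite /reduced_vertex => /enum_val_inj e.
  by have := enum_valP i; rewrite in_setC e vT.
apply/imsetP=> [[j jS /(embedding_reduced T).1 e]]; by rewrite e jS in iS.
Qed.
End Reduction.

(** * Programs *)

Definition eincr (x : nat) : expr := EOp Add (EVar x) (ECst 1).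
Definition edecr (x : nat) : expr := EOp Defs.Sub (EVar x) (ECst 1).

(* Leaves in x the first value for which e vanishes. *)
Definition scan (R x : nat) (e : expr) : cmd :=
  Seq (assign R x (ECst 0)) (Seq (assign R ra e)
    (While ra (Seq (assign R x (eincr x)) (assign R ra e)))).

Definition scan_k (R : nat) : cmd := scan R rk (ERead (EVar rk)).

Definition scan_n (R : nat) : cmd := scan R rn (ERead (EOp Add (eincr rk) (EVar rn))).

Definition power_step (R : nat) : cmd :=
  Seq (assign R rm (EOp Add (EVar rm) (EVar rm))) (assign R ra (edecr ra)).

Definition power (R : nat) (e : expr) : cmd :=
  Seq (assign R ra e) (Seq (assign R rm (ECst 1)) (While ra (power_step R))).

(** One exponent serves all expressions of a program and is fixed before the input, as the constant
    in the logarithmic term requires. *)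
Lemma admissible_list (l : seq expr) : exists D, forall w R N B,
  all (fun e => vbound e <= R) l -> (N + 2) ^ D.+1 <= B ->
  foldr (fun e P => admissible w B N R e /\ P) True l.
Proof.
elim: l => [|e l [D IH]]; first by exists 0.
have [De fe] := fits_poly e; exists (maxn De D) => w R N B /= /andP[eR lR] le.
have up D1 : D1 <= maxn De D -> (N + 2) ^ D1.+1 <= B.
  by move=> le1; apply: leq_trans le; rewrite leq_exp2l // addn2.
split; last by apply: IH => //; apply: up; apply: leq_maxr.
split=> // s sN; apply: fits_mono (up De (leq_maxl _ _)) (fe w s N _) => i ie.
by apply: sN; apply: leq_trans eR.
Qed.

Section Runs.
Variables (w : seq bool) (W B N R : nat).
Hypotheses (N2 : 2 <= N) (NB : N <= B) (RW : R <= W) (R8 : 8 <= R).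
Local Notation run := (exec w (below W B)).
Local Notation good := (good W B N R).
Local Notation admissible := (admissible w B N R).

Definition same_but (l : seq nat) (s s' : store) :=
  forall i, i < R -> i \notin l -> s' i = s i.

Lemma run_set x e v s : x < R -> good s -> admissible e -> eval w s e = v -> v <= N ->
  exists s', [/\ run (assign R x e) s s', good s', s' x = v & same_but [:: x] s s'].
Proof.
move=> xR gs ae ev vN; rewrite -ev in vN *.
have [s' [r g E]] := run_assign N2 NB RW xR gs ae vN.
exists s'; split=> //; first by rewrite E // upd_same.
by move=> i iR; rewrite inE => ix; rewrite E // upd_other.
Qed.

Lemma run_scan x e L s : x < 4 -> good s -> admissible e -> admissible (eincr x) ->
    admissible (ECst 0) -> L <= N ->
    (forall s', same_but [:: x; ra] s s' -> s' x <= L -> eval w s' e = (s' x < L)) ->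
  exists s', [/\ run (scan R x e) s s', good s', s' x = L & same_but [:: x; ra] s s'].
Proof.
move=> x4 gs ae ai a0 LN eE; have xR : x < R by lia.
have aR : ra < R by lia.
have xa : x != ra by lia.
have [s1 [r1 g1 v1 p1]] := run_set xR gs a0 erefl (leq0n _).
have q1 : same_but [:: x; ra] s s1.
  by move=> i iR; rewrite !inE negb_or => /andP[ix _]; apply: p1; rewrite ?inE.
have e1 : eval w s1 e = (0 < L) by rewrite eE ?v1.
have [|s2 [r2 g2 v2 p2]] := run_set aR g1 ae e1; first by case: (0 < L); lia.
have trans2 s3 s4 s5 :
    same_but [:: x; ra] s3 s4 -> same_but [:: ra] s4 s5 -> same_but [:: x; ra] s3 s5.
  move=> H1 H2 i iR H; rewrite H2 ?H1 // inE.
  by move: H; rewrite !inE negb_or => /andP[].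
pose I j t := [/\ good t, j <= L, t x = L - j, t ra = (0 < j) & same_but [:: x; ra] s t].
have I2 : I L s2.
  split=> //; last exact: trans2 q1 p2.
  by rewrite p2 ?v1 ?subnn // inE.
have [|j t [gt jL tx ta pt]|s3 r3 [g3 _ x3 _ p3]] :=
  exec_while (w := w) (ok := below W B) (I := I) (x := ra)
    (c := Seq (assign R x (eincr x)) (assign R ra e)) _ _ I2.
- by move=> t [_ _ _].
- split; first by rewrite ta.
  have ev : eval w t (eincr x) = L - j by rewrite /= tx; lia.
  have [|t1 [q1' g1' x1 p1']] := run_set xR gt ai ev; first by lia.
  have pt1 : same_but [:: x; ra] s t1.
    move=> i iR H; rewrite p1' ?pt // inE.
    by move: H; rewrite !inE negb_or => /andP[].
  have et : eval w t1 e = (0 < j) by rewrite eE ?x1 //; [congr nat_of_bool|]; lia.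
  have [|t2 [q2 g2' a2 p2']] := run_set aR g1' ae et; first by case: (0 < j); lia.
  exists t2; first exact: exec_seq q1' q2.
  split=> //; first exact: ltnW.
    by rewrite p2' ?x1 // inE.
  exact: trans2 pt1 p2'.
exists s3; split=> //; last by rewrite x3 subn0.
by apply: exec_seq r1 _; apply: exec_seq r2 _.
Qed.

Lemma run_power e b s : good s -> admissible e -> admissible (ECst 1) ->
    admissible (EOp Add (EVar rm) (EVar rm)) -> admissible (edecr ra) ->
    eval w s e = b -> 2 ^ b <= N ->
  exists s', [/\ run (power R e) s s', good s', s' rm = 2 ^ b & same_but [:: rm; ra] s s'].
Proof.
move=> gs ae a1 aa ad eb bN.
have mR : rm < R by lia.
have aR : ra < R by lia.
have lb : b <= N by apply: leq_trans bN; apply: ltnW; apply: ltn_expl.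
have [s1 [r1 g1 v1 p1]] := run_set aR gs ae eb lb.
have [|s2 [r2 g2 v2 p2]] := run_set mR g1 a1 erefl; first by rewrite /=; lia.
have comb s3 s4 s5 z : z \in [:: rm; ra] ->
    same_but [:: rm; ra] s3 s4 -> same_but [:: z] s4 s5 -> same_but [:: rm; ra] s3 s5.
  move=> zl H1 H2 i iR H; rewrite H2 ?H1 // inE.
  by apply: contraNneq H => ->.
have q1 : same_but [:: rm; ra] s s1 by apply: comb p1.
pose I j t := [/\ good t, j <= b, t ra = j, t rm = 2 ^ (b - j) & same_but [:: rm; ra] s t].
have I2 : I b s2.
  split=> //; first by rewrite p2.
    by rewrite v2 subnn.
  exact: comb q1 p2.
have [|j t [gt jb ta tm pt]|s3 r3 [g3 _ a3 m3 p3]] :=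
  exec_while (w := w) (ok := below W B) (I := I) (x := ra) (c := power_step R) _ _ I2.
- by move=> t [].
- split; first by rewrite ta.
  have ev : eval w t (EOp Add (EVar rm) (EVar rm)) = 2 ^ (b - j).
    by rewrite /= tm -(subSS j) subSn // expnS mul2n addnn.
  have [|t1 [q1' g1' m1 p1']] := run_set mR gt aa ev.
    by apply: leq_trans bN; rewrite leq_exp2l // leq_subr.
  have ev2 : eval w t1 (edecr ra) = j by rewrite /= p1' // ta subn1.
  have [|t2 [q2 g2' a2 p2']] := run_set aR g1' ad ev2; first by lia.
  exists t2; first exact: exec_seq q1' q2.
  split=> //; first exact: ltnW.
    by rewrite p2'.
  exact: comb (comb _ _ _ rm _ pt p1') p2'.
exists s3; split=> //; last by rewrite m3 subn0.
by apply: exec_seq r1 _; apply: exec_seq r2 _.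
Qed.
End Runs.

Lemma width_gt0 c : 0 < width c.
Proof. by elim: c => //= *; rewrite !leq_max; try apply/orP; auto. Qed.

(** * The search over masks *)

(** Register [V] is register 0 of the simulated program and so holds its answer. The real register 0
    is set on success and never reset, which records a disjunction over all masks. *)
Definition search_step (Phi : seq sgraph) (c : cmd) (R V : nat) : cmd :=
  Seq (assign R rm (edecr rm)) (Seq (assign R ra (ecandidate Phi))
    (If ra (Seq (Seq (clear_regs V (width c)) (sim R V ra (eread Phi) c))
                (If V (Const 0 1) Skip))
           Skip)).

Definition search (Phi : seq sgraph) (c : cmd) (R V : nat) : cmd :=
  Seq (scan_k R) (Seq (scan_n R)
    (Seq (power R (ekernel_bound Phi)) (While rm (search_step Phi c R V)))).

Definition search_exprs (Phi : seq sgraph) : seq expr :=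
  [:: ERead (EVar rk); ERead (EOp Add (eincr rk) (EVar rn)); eincr rk; eincr rn; ECst 0;
      ECst 1; EOp Add (EVar rm) (EVar rm); edecr ra; edecr rm; ekernel_bound Phi;
      ecandidate Phi; eread Phi].

Section Search.
Variables (Phi : seq sgraph) (c : cmd) (G : sgraph) (k W B N R V : nat).
Variable Y : nat -> Prop.
Local Notation n := #|G|.
Local Notation P := (2 ^ kernel_bound Phi k).
Local Notation S := (chosen Phi G k).
Hypotheses (N2 : 2 <= N) (NB : N <= B) (RW : R <= W) (V8 : 8 <= V) (VR : V + width c <= R).
Hypotheses (kN : k <= N) (nN : n <= N) (PN : P <= N).
Hypothesis solve : forall m, candidate Phi G k m -> exists2 s,
  exec (enc_graph (reduced (S m), k - #|S m|)) (below (width c) N) c init_store s &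
  s 0 != 0 <-> Y m.
Variable w : seq bool.
Hypothesis w_enc : w = enc_graph (G, k).
Hypothesis adm :
  foldr (fun e P => admissible w B N R e /\ P) True (search_exprs Phi).
Local Notation run := (exec w (below W B)).

(** Masks are tried in decreasing order, so this is what register 0 must report when the mask
    counter stands at [j]. *)
Definition found (j : nat) := exists m, [/\ j <= m < P, candidate Phi G k m & Y m].

Lemma run_search_step j t : good W B N R t -> t rk = k -> t rn = n -> t rm = j.+1 ->
    j < P -> (t 0 != 0 <-> found j.+1) ->
  exists2 t', run (search_step Phi c R V) t t' &
    [/\ good W B N R t', t' rk = k, t' rn = n, t' rm = j & (t' 0 != 0 <-> found j)].
Proof.
move=> gt tk tn tm jP t0; have R8 : 8 <= R by lia.
have wa (u v : 'I_n) : read_input w (k + n + 2 + u * n + v) = adj (enum_val u : G) (enum_val v).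
  by rewrite w_enc read_enc_adj.
case: adm => _ [_ [_ [_ [_ [_ [_ [_ [ad [_ [ac [ar _]]]]]]]]]]].
have mR : rm < R by lia.
have aR : ra < R by lia.
have ev1 : eval w t (edecr rm) = j by rewrite /= tm subn1.
have [|t1 [r1 g1 m1 p1]] := run_set N2 NB RW mR gt ad ev1; first by lia.
have b1 : base G k j t1 by split=> //; rewrite p1 //; lia.
have ev2 := eval_ecandidate Phi wa b1.
have [|t2 [r2 g2 a2 p2]] := run_set N2 NB RW aR g1 ac ev2.
  by rewrite (leq_trans (leq_b1 _)) //; lia.
have b2 i : i < 4 -> t2 i = t1 i by move=> i4; rewrite p2 ?inE //; lia.
have found_step : found j <-> (candidate Phi G k j /\ Y j) \/ found j.+1.
  split=> [[m [/andP[jm mP] cm Ym]]|[[cj Yj]|[m [/andP[jm mP] cm Ym]]]].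
  - case: (ltngtP j m) jm => // [lt|e] _; first by right; exists m; rewrite lt.
    by left; rewrite e.
  - by exists j; rewrite leqnn.
  - by exists m; rewrite (ltnW jm).
have t20 : t2 0 = t 0 by rewrite b2 // p1 //; lia.
case: (boolP (candidate Phi G k j)) => cj; last first.
  exists t2.
    apply: exec_seq r1 _; apply: exec_seq r2 _; apply: exec_if_false; last by constructor.
    by rewrite a2 -[_ && _]/(candidate Phi G k j) (negPf cj).
  split=> //; rewrite ?b2 ?m1 //; try by case: b1.
  by rewrite -b2 // t20 t0 found_step (negPf cj); split=> [|[[]|]] //; right.
have [s rs sY] := solve cj.
have okN s1 : below (width c) N s1 -> forall i, i < width c -> s1 i <= N by move/belowP.
have rdE s1 : good W B N R s1 -> (forall i, i < V -> i != ra -> s1 i = t2 i) ->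
    eval w s1 (eread Phi) = read_input (enc_graph (reduced (S j), k - #|S j|)) (s1 ra).
  move=> g E; apply: eval_eread => //.
  by case: b1 => e1 e2 e3; split; rewrite E ?b2 //; lia.
have aV : ra < V by lia.
have [t3 [r3 g3 [v3 p3]]] :=
  run_sim_init N2 NB RW VR aV ar okN rdE rs (leqnn _) g2 (fun i _ _ => erefl).
have t3V : t3 V = s 0 by rewrite -v3 ?addn0 // width_gt0.
have q3 i : i < 4 -> t3 i = t1 i by move=> i4; rewrite p3 ?b2 //; lia.
have pre t' : run (If V (Const 0 1) Skip) t3 t' -> run (search_step Phi c R V) t t'.
  move=> r4; apply: exec_seq r1 _; apply: exec_seq r2 _; apply: exec_if_true.
    by rewrite a2 -[_ && _]/(candidate Phi G k j) cj.
  exact: exec_seq r3 r4.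
have [e1 e2 e3] := b1.
have [sz|snz] := eqVneq (s 0) 0.
  exists t3; first by apply: pre; apply: exec_if_false; [rewrite t3V | constructor].
  split=> //; rewrite ?q3 //.
  rewrite -b2 // t20 t0 found_step; split=> [|[[_ Yj]|]] //; first by right.
  by move/sY: Yj; rewrite sz.
have g4 : good W B N R (upd t3 0 1) by apply: good_upd => //; lia.
exists (upd t3 0 1).
  apply: pre; apply: exec_if_true; first by rewrite t3V.
  by constructor; case: g4.
split=> //; try by rewrite upd_other // q3.
by rewrite upd_same found_step; split=> // _; left; split=> //; apply/sY.
Qed.

Lemma run_search : exists2 s, run (search Phi c R V) init_store s & s 0 != 0 <-> found 0.
Proof.
have R8 : 8 <= R by lia.
have gi : good W B N R init_store by split=> //; apply/belowP.
case: (adm) => [ak [an [aik [ain [a0 [a1 [aa [ada [_ [ab _]]]]]]]]]].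
have [||s1 [r1 g1 k1 p1]] := run_scan N2 NB RW R8 (x := rk) (L := k) _ gi ak aik a0 kN _ => //.
  move=> s' _ le; rewrite /= w_enc read_enc_graph.
  by case: ltnP => // ge; rewrite ifT //; apply/eqP; lia.
have [||s2 [r2 g2 n2 p2]] := run_scan N2 NB RW R8 (x := rn) (L := n) _ g1 an ain a0 nN _ => //.
  move=> s' E le; rewrite /= E ?k1 //; last by lia.
  rewrite w_enc read_enc_graph; do 2 (case: ifP => [|_]; first by lia).
  rewrite ltn_add2l; case: ltnP => // ge; rewrite ifT //; apply/eqP; lia.
have k2 : s2 rk = k by rewrite p2 ?k1 //; lia.
have eb : eval w s2 (ekernel_bound Phi) = kernel_bound Phi k by rewrite eval_ekernel_bound k2.
have [s3 [r3 g3 m3 p3]] := run_power N2 NB RW R8 g2 ab a1 aa ada eb PN.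
pose I j t := j <= P /\
  [/\ good W B N R t, t rk = k, t rn = n, t rm = j & (t 0 != 0 <-> found j)].
have I3 : I P s3.
  have s30 : s3 0 = 0 by rewrite p3 ?p2 ?p1 //; lia.
  split=> //; split=> //; try by rewrite p3 //; lia.
  by rewrite s30; split=> // [[m [/andP[le lt]]]]; move: (leq_ltn_trans le lt); rewrite ltnn.
have [|j t [jP [gt tk tn tm t0]]|s4 r4 [_ [_ _ _ _ s40]]] :=
  exec_while (w := w) (ok := below W B) (I := I) (x := rm)
    (c := search_step Phi c R V) _ _ I3.
- by move=> t [_ []].
- split; first by rewrite tm.
  have [t' r' It'] := run_search_step gt tk tn tm jP t0.
  by exists t' => //; split; first exact: ltnW.
exists s4 => //.
by apply: exec_seq r1 _; apply: exec_seq r2 _; apply: exec_seq r3 r4.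
Qed.
End Search.

Definition all_vars (l : seq expr) : nat := foldr (fun e => maxn (vbound e)) 8 l.

Lemma all_vars_ge8 l : 8 <= all_vars l.
Proof. by elim: l => //= e l IH; rewrite leq_max IH orbT. Qed.

Lemma all_varsP l R : all_vars l <= R -> all (fun e => vbound e <= R) l.
Proof. by elim: l => //= e l IH; rewrite geq_max => /andP[-> /IH]. Qed.

Lemma exec_predT w ok c s s' : exec w ok c s s' -> exec w predT c s s'.
Proof. exact: exec_weaken. Qed.

Lemma Del_computable_param Pi : computable_param (Del Pi).
Proof.
pose l := [:: ERead (EVar rk); eincr rk; ECst 0; EVar rk].
exists (Seq (scan_k 8) (assign 8 0 (EVar rk))) => [[G k] _].
have [D adm] := admissible_list l.
pose N := k + 2; pose w := enc_graph (G, k).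
have N2 : 2 <= N by rewrite /N; lia.
have NB : N <= (N + 2) ^ D.+1.
  by apply: (@leq_trans (N + 2)); [lia | rewrite -{1}(expn1 (N + 2)) leq_exp2l // addn2].
have [ak [ai [a0 [av _]]]] := adm w 8 N _ (all_varsP (leqnn 8 : all_vars l <= 8)) (leqnn _).
have gi : good 8 ((N + 2) ^ D.+1) N 8 init_store by split=> //; apply/belowP.
have kN : k <= N by rewrite /N; lia.
have [||s1 [r1 g1 k1 p1]] :=
    run_scan N2 NB (leqnn 8) (leqnn 8) (x := rk) (L := k) _ gi ak ai a0 kN _ => //.
  move=> s' _ le; rewrite /eval -/eval /w read_enc_graph.
  by case: ltnP => // ge; rewrite ifT //; apply/eqP; lia.
have [//|s2 [r2 g2 v2 p2]] := run_set N2 NB (leqnn 8) (x := 0) (s := s1) _ g1 av k1 kN.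
by exists s2 => //; apply: (exec_predT (ok := below 8 ((N + 2) ^ D.+1))); apply: exec_seq r1 r2.
Qed.

(** * Computability of the new parameter bound *)

Section ComputableBound.
Variables (Phi : seq sgraph) (f : nat -> nat) (c : cmd) (C1 C2 : nat).
Hypothesis cf : forall j, outputs c (nseq j true) (f j).

(** The virtual input 1^j, with [j] kept in [rm]; the value 2 imitates a read past its end. *)
Definition eunary : expr := eif (elt (EVar ra) (EVar rm)) (ECst 1) (ECst 2).

Definition eresult : expr :=
  EOp Add (EOp Mul (ECst C1) (EOp Add (EVar rn) (ekernel_bound Phi))) (ECst C2).

Definition sum_exprs (V : nat) : seq expr :=
  [:: EOp Defs.Sub (ECst 2) (ERead (EVar rk)); eincr rk; ECst 0; edecr rm;
      EOp Add (EVar rn) (EVar V); eunary; eresult].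

Definition sum_loop (R V : nat) : cmd :=
  Seq (assign R rm (edecr rm)) (Seq (Seq (clear_regs V (width c)) (sim R V ra eunary c))
    (assign R rn (EOp Add (EVar rn) (EVar V)))).

(** The unary argument has no terminator, so the scan tests for the end-of-input value 2: the
    difference vanishes exactly there. *)
Definition sum_program (R V : nat) : cmd :=
  Seq (scan R rk (EOp Defs.Sub (ECst 2) (ERead (EVar rk))))
    (Seq (assign R rm (eincr rk)) (Seq (assign R rn (ECst 0))
      (Seq (While rm (sum_loop R V)) (assign R 0 eresult)))).

(** How much space the bound function takes to compute is irrelevant, so any [N] covering these
    finitely many runs is good enough. *)
Lemma outputs_common_bound k : exists N, forall j, j < k ->
  exists2 s, exec (nseq j true) (below (width c) N) c init_store s & s 0 = f j.
Proof.
elim: k => [|k [N IH]]; first by exists 0.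
have [s /(exec_bounded (width c))[N' r] s0] := cf k; exists (maxn N N') => j.
have up M s1 s2 w1 : M <= maxn N N' -> exec w1 (below (width c) M) c s1 s2 ->
    exec w1 (below (width c) (maxn N N')) c s1 s2.
  by move=> le; apply: exec_weaken => t; apply: below_mono.
rewrite ltnS leq_eqVlt => /orP[/eqP->|/IH[s' r' v']].
  by exists s => //; apply: up r; apply: leq_maxr.
by exists s' => //; apply: up r'; apply: leq_maxl.
Qed.

Lemma computable_sum_bound :
  computable (fun k => C1 * (\sum_(j < k.+1) f j + kernel_bound Phi k) + C2).
Proof.
(* [sum_exprs] mentions [V] and cannot be used to define it; the expressions left out involve only
   low registers and [V] itself, all below [R]. *)
pose V := all_vars [:: eunary; eresult].
have V8 : 8 <= V := all_vars_ge8 _.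
pose R := V + width c.
have cR := width_gt0 c.
have RV : all (fun e => vbound e <= R) (sum_exprs V).
  have := all_varsP (leqnn V); rewrite -/V /sum_exprs /= !geq_max => /and3P[e1 e2 _].
  by rewrite /R; do ?[apply/andP; split]; try (by lia); apply: leq_trans (leq_addr _ _).
have [D adm] := admissible_list (sum_exprs V).
exists (sum_program R V) => k; set w := nseq k true.
pose Fk := C1 * (\sum_(j < k.+1) f j + kernel_bound Phi k) + C2.
rewrite -/Fk.
have [N0 runs] := outputs_common_bound k.+1.
pose N := N0 + k + 2 + \sum_(j < k.+1) f j + Fk.
have N2 : 2 <= N by rewrite /N; lia.
set B := (N + 2) ^ D.+1.
have NB : N <= B.
  by apply: (@leq_trans (N + 2)); [lia | rewrite -{1}(expn1 (N + 2)) leq_exp2l // addn2].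
have [ak [ai [a0 [ad [aa [au [ar _]]]]]]] := adm w R N B RV (leqnn _).
have R8 : 8 <= R by rewrite /R; lia.
have gi : good R B N R init_store by split=> //; apply/belowP.
have kN : k < N by rewrite /N; lia.
have [||s1 [r1 g1 k1 p1]] :=
    run_scan N2 NB (leqnn R) R8 (x := rk) (L := k) _ gi ak ai a0 (ltnW kN) _ => //.
  move=> s' _ le; rewrite /= /w /read_input map_nseq nth_nseq.
  by case: ltnP.
have mR : rm < R by lia.
have nR : rn < R by lia.
have ev2 : eval w s1 (eincr rk) = k.+1 by rewrite /= k1 addn1.
have [s2 [r2 g2 m2 p2]] := run_set N2 NB (leqnn R) mR g1 ai ev2 kN.
have [s3 [r3 g3 n3 p3]] := run_set N2 NB (leqnn R) nR g2 a0 erefl (leq0n _).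
pose G j := \sum_(j <= i < k.+1) f i.
have GN j : G j <= N.
  apply: (@leq_trans (\sum_(i < k.+1) f i)); last by rewrite /N; lia.
  rewrite -(big_mkord xpredT f) /G; case: (leqP j k.+1) => [le|gt].
    by rewrite (@big_cat_nat _ _ _ j 0) //= leq_addl.
  by rewrite big_geq // ltnW.
pose I j t := [/\ good R B N R t, j <= k.+1, t rk = k, t rm = j & t rn = G j].
have I3 : I k.+1 s3.
  split=> //; first by rewrite p3 ?p2 ?k1 //; lia.
    by rewrite p3 //; lia.
  by rewrite n3 /G big_geq.
have [|j t [gt jk tk tm tn]|s4 r4 [g4 _ k4 m4 n4]] :=
  exec_while (w := w) (ok := below R B) (I := I) (x := rm) (c := sum_loop R V) _ _ I3.
- by move=> t [].
- split; first by rewrite tm.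
  have ev : eval w t (edecr rm) = j by rewrite /= tm subn1.
  have [|t1 [q1 h1 m1 o1]] := run_set N2 NB (leqnn R) mR gt ad ev; first by lia.
  have [s rs sv] := runs j jk.
  have okN s' : below (width c) N0 s' -> forall i, i < width c -> s' i <= N.
    by move=> /belowP b i /b le; apply: leq_trans le _; rewrite /N; lia.
  have rdE s' : good R B N R s' -> (forall i, i < V -> i != ra -> s' i = t1 i) ->
      eval w s' eunary = read_input (nseq j true) (s' ra).
    move=> _ E; rewrite eval_eif eval_elt eqb0 negbK !eval_evar (E rm) ?m1 //; last by lia.
    by rewrite /read_input map_nseq nth_nseq; case: ltnP.
  have aV : ra < V by lia.
  have [t2 [q2 h2 [v2 o2]]] :=
    run_sim_init N2 NB (leqnn R) (leqnn R) aV au okN rdE rs (leqnn _) h1 (fun i _ _ => erefl).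
  have t2V : t2 V = f j by rewrite -sv -v2 ?addn0 // width_gt0.
  have t2n : t2 rn = G j.+1 by rewrite o2 ?o1 //; lia.
  have ev3 : eval w t2 (EOp Add (EVar rn) (EVar V)) = G j.
    by rewrite /= t2V t2n /G [in RHS]big_ltn // addnC.
  have [t3 [q3 h3 n3' o3]] := run_set N2 NB (leqnn R) nR h2 aa ev3 (GN j).
  exists t3; first by apply: exec_seq q1 _; apply: exec_seq q2 q3.
  split=> //; first exact: ltnW.
    by rewrite o3 ?o2 ?o1 //; lia.
  by rewrite o3 ?o2 ?m1 //; lia.
have ev5 : eval w s4 eresult = Fk.
  rewrite /= eval_ekernel_bound k4 n4 /G /Fk; congr (C1 * (_ + _) + C2).
  by rewrite big_mkord.
have zR : 0 < R by lia.
have [|s5 [r5 g5 v5 p5]] := run_set N2 NB (leqnn R) zR g4 ar ev5; first by rewrite /N; lia.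
exists s5 => //; apply: (exec_predT (ok := below R B)).
by do 4 (apply: exec_seq; [eassumption|]).
Qed.
End ComputableBound.

Theorem theorem1 (Pi Psi : graph_class) (Phi : seq sgraph)
    (Pi_sub_Psi : forall G : sgraph, Pi G -> Psi G)
    (Psi_char : characterized_by Psi Phi)
    (ResDel_para_L : para_L (ResDel Pi Psi)) :
  para_L (Del Pi).
Proof.
case: ResDel_para_L => _ [f [a [[cf f_cf] [c solves]]]].
split; first exact: Del_computable_param.
pose V := all_vars (search_exprs Phi); pose R := V + width c.
pose prog := search Phi c R V; pose W := maxn (width prog) R.
have [D adm] := admissible_list (search_exprs Phi).
pose q := W * D.+1.
(* [W] registers of at most [E.+1] bits, with [E = F0.+1 * D.+1] below, take [q * F0 + q + W] bits.
   Splitting [F0] into its part in [k] and its multiple of the bit length gives the two terms. *)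
exists (fun k => q * (\sum_(j < k.+1) f j + kernel_bound Phi k) + (q + W)), (q * a.+1).
split; first exact: (computable_sum_bound _ _ _ f_cf).
exists prog => [[G k] _].
pose w := enc_graph (G, k); pose b := bitlen (size w).
(* [2 ^ F0] bounds every number kept: [f] and [a * b] pay for the given algorithm, [kernel_bound]
   for the masks, and the extra [b] in [a.+1 * b] for [#|G|] and [k]. *)
pose F0 := \sum_(j < k.+1) f j + kernel_bound Phi k + a.+1 * b.
(* Since [N + 2 <= 2 * N], the polynomial bound [(N + 2) ^ D.+1] is at most [2 ^ (F0.+1 * D.+1)]. *)
pose N := 2 ^ F0; pose E := F0.+1 * D.+1; pose B := 2 ^ E.
have b_le : b <= F0 by rewrite /F0 mulSn; lia.
have F0_gt0 : 0 < F0 by apply: leq_trans b_le.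
have N2 : 2 <= N by rewrite -{1}(expn1 2) leq_exp2l.
have NB : N <= B by rewrite leq_exp2l // /E; nia.
have DB : (N + 2) ^ D.+1 <= B.
  by rewrite /B /E expnM leq_exp2r // expnS mul2n -addnn leq_add2l.
have size_lt : size w < N by apply: leq_trans (ltn_exp_bitlen _) _; rewrite leq_exp2l.
have wE : size w = k + #|G| + 2 + #|G| * #|G| by rewrite size_enc_graph.
have kN : k <= N by apply: leq_trans (ltnW size_lt); rewrite wE -!addnA leq_addr.
have nN : #|G| <= N.
  by apply: leq_trans (ltnW size_lt); rewrite wE (addnC k) -!addnA leq_addr.
have PN : 2 ^ kernel_bound Phi k <= N by rewrite leq_exp2l // /F0; lia.
have VR : V <= R := leq_addr _ _.
pose S m := chosen Phi G k m.
pose Y m := yes (p := Del Pi) (reduced (S m), k - #|S m|).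
have solve m : candidate Phi G k m -> exists2 s,
    exec (enc_graph (reduced (S m), k - #|S m|)) (below (width c) N) c init_store s &
    s 0 != 0 <-> Y m.
  move=> cm; have cl := candidate_class Psi_char cm.
  have [v [_ [s rs <-]] vY] := solves (reduced (S m), k - #|S m|) (conj I cl).
  exists s => //; apply: exec_weaken rs => t /= le; apply/belowP=> i ic.
  apply: ltnW; apply: leq_trans (space_reg t ic) _; rewrite leq_exp2l //.
  apply: leq_trans le _; rewrite /F0 mulSn.
  have fle : f (k - #|S m|) <= \sum_(j < k.+1) f j.
    have lt : k - #|S m| < k.+1 by rewrite ltnS leq_subr.
    by rewrite (bigD1 (Ordinal lt)) //= leq_addr.
  have ble : bitlen (size (enc_graph (reduced (S m), k - #|S m|))) <= b.
    apply: bitlen_mono; rewrite wE size_enc_graph card_reduced -/(S m).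
    by apply: leq_add; [rewrite leq_add2r leq_add ?leq_subr | rewrite leq_mul ?leq_subr].
  apply: leq_add; first exact: leq_trans fle (leq_addr _ _).
  exact: leq_trans (leq_mul (leqnn a) ble) (leq_addl _ _).
have [|s rs sY] := run_search (R := R) (V := V) (W := W) N2 NB _ (all_vars_ge8 _)
  (leqnn _) kN nN PN solve erefl (adm w R N B (all_varsP VR) DB); first exact: leq_maxr.
have ok_space t : below W B t ->
    space prog t <= q * (\sum_(j < k.+1) f j + kernel_bound Phi k) + (q + W) + q * a.+1 * b.
  move=> /(space_below (leq_maxl _ _)) le; apply: leq_trans le _.
  by rewrite /E /F0 /q; nia.
exists (s 0).
  split; first by apply: ok_space; apply/belowP.
  by exists s => //; apply: exec_weaken rs => t /ok_space.
rewrite sY (Del_yes_candidates Pi_sub_Psi Psi_char).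
split=> [[m [/andP[_ lt] cm Ym]]|[m [lt cm Ym]]].
  by exists m.
by exists m.
Qed.
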